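(* Let $1\le p<\infty$ and let $d_{w,p}$ be a Lorentz sequence space which has exactly two mutually non-equivalent symmetric basic sequences (up to equivalence). Then $\overline{J^j}$ is the only immediate successor of $\mathcal K(d_{w,p})$ among closed ideals of $L(d_{w,p})$; that is, $\mathcal K(d_{w,p})\subsetneq \overline{J^j}$, there is no closed ideal strictly between them, and every closed ideal $J$ of $L(d_{w,p})$ with $\mathcal K(d_{w,p})\subsetneq J$ satisfies $\overline{J^j}\subseteq J$.
   Context: Let $1\le p<\infty$ and let $w=(w_n)$ be a real sequence with $w_1=1$, $w_n\downarrow 0$ and $\sum_n w_n=\infty$. The Lorentz sequence space $d_{w,p}$ is the Banach space of all $x=(x_n)\in c_0$ with $\|x\|_{d_{w,p}}=\big(\sum_{n}w_n (x^*_n)^p\big)^{1/p}<\infty$, where $(x^*_n)$ is the non-increasing rearrangement of $(|x_n|)$. Let $(e_n)$, $(f_n)$ be the unit vector bases of $d_{w,p}$, $\ell_p$, and $j\colon\ell_p\to d_{w,p}$ the formal identity, $j(f_n)=e_n$. $J^j$ is the set of $S\in L(d_{w,p})$ of the form $S=AjB$ with $A\in L(d_{w,p})$, $B\in L(d_{w,p},\ell_p)$; $\overline{J^j}$ is its norm closure. $\mathcal K(d_{w,p})$ is the ideal of compact operators. For closed ideals $J_1\subsetneq J_2$, $J_2$ is an immediate successor of $J_1$ if no closed ideal $J$ satisfies $J_1\subsetneq J\subsetneq J_2$. Two basic sequences $(x_n),(y_n)$ are equivalent if $\sum a_nx_n$ converges iff $\sum a_ny_n$ converges. *)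

(* Defs.v *)
From Stdlib Require Import Reals List.
From Coquelicot Require Import Coquelicot.
Open Scope R_scope.

(** Sequences are functions nat -> R; index n (0-based) = paper's n+1. *)
Definition seqR := nat -> R.

Definition sadd (x y : seqR) : seqR := fun k => x k + y k.
Definition ssub (x y : seqR) : seqR := fun k => x k - y k.
Definition sscale (a : R) (x : seqR) : seqR := fun k => a * x k.

(** t^q for t >= 0 (with 0^q = 0), avoiding Rpower's convention at 0. *)
Definition rpow (t q : R) : R := if Rle_dec t 0 then 0 else Rpower t q.

Definition in_c0 (x : seqR) : Prop := is_lim_seq x 0.

Definition tailsup (x : seqR) (F : list nat) : R :=
  real (Lub_Rbar (fun t => exists k, ~ In k F /\ t = Rabs (x k))).

(** Non-increasing rearrangement of (|x_k|) (for x in c_0):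
    xstar x n = inf over sets F of at most n indices of sup_{k not in F} |x_k|,
    i.e. the (n+1)-th largest value of |x|. *)
Definition xstar (x : seqR) (n : nat) : R :=
  real (Glb_Rbar (fun r => exists F : list nat, (length F <= n)%nat /\ r = tailsup x F)).

Section Lorentz.
Variables (w : seqR) (p : R).

Definition in_d (x : seqR) : Prop :=
  in_c0 x /\ ex_series (fun n => w n * rpow (xstar x n) p).

Definition dnorm (x : seqR) : R :=
  rpow (Series (fun n => w n * rpow (xstar x n) p)) (1 / p).

Definition in_lp (x : seqR) : Prop := ex_series (fun n => rpow (Rabs (x n)) p).

Definition lpnorm (x : seqR) : R := rpow (Series (fun n => rpow (Rabs (x n)) p)) (1 / p).

(** bounded linear operators d_{w,p} -> d_{w,p}, represented by their action on d *)
Definition op := seqR -> seqR.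

Definition bounded_d (T : op) : Prop :=
  (forall x, in_d x -> in_d (T x)) /\
  (forall x y a b, in_d x -> in_d y ->
     forall k, T (sadd (sscale a x) (sscale b y)) k = a * T x k + b * T y k) /\
  (exists C, forall x, in_d x -> dnorm (T x) <= C * dnorm x).

Definition bounded_d_lp (B : op) : Prop :=
  (forall x, in_d x -> in_lp (B x)) /\
  (forall x y a b, in_d x -> in_d y ->
     forall k, B (sadd (sscale a x) (sscale b y)) k = a * B x k + b * B y k) /\
  (exists C, forall x, in_d x -> lpnorm (B x) <= C * dnorm x).

Definition opdist_le (T S : op) (eps : R) : Prop :=
  forall x, in_d x -> dnorm (ssub (T x) (S x)) <= eps * dnorm x.

Definition op_closure (A : op -> Prop) (T : op) : Prop :=
  bounded_d T /\ forall eps, 0 < eps -> exists S, A S /\ opdist_le T S eps.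

(** compact operators: image of the unit ball is totally bounded
    (equivalently relatively compact, d_{w,p} being complete) *)
Definition compact_op (T : op) : Prop :=
  bounded_d T /\
  forall eps, 0 < eps -> exists L : list seqR,
    (forall z, In z L -> in_d z) /\
    forall x, in_d x -> dnorm x <= 1 ->
      exists z, In z L /\ dnorm (ssub (T x) z) <= eps.

(** J^j : operators S = A j B, A in L(d), B in L(d, l_p), j the formal identity *)
Definition Jj (S : op) : Prop :=
  bounded_d S /\
  exists A B, bounded_d A /\ bounded_d_lp B /\
    forall x, in_d x -> forall k, S x k = A (B x) k.

Definition Jj_closure : op -> Prop := op_closure Jj.

Definition closed_ideal (J : op -> Prop) : Prop :=
  (forall T, J T -> bounded_d T) /\
  J (fun _ _ => 0) /\
  (forall S T, J S -> J T -> J (fun x => sadd (S x) (T x))) /\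
  (forall a T, J T -> J (fun x => sscale a (T x))) /\
  (forall A T, bounded_d A -> J T -> J (fun x => A (T x))) /\
  (forall A T, bounded_d A -> J T -> J (fun x => T (A x))) /\
  (forall T, op_closure J T -> J T).

Definition psum (xs : nat -> seqR) (a : seqR) (N : nat) : seqR :=
  fun k => sum_n (fun i => a i * xs i k) N.

Definition series_conv_to (xs : nat -> seqR) (a : seqR) (y : seqR) : Prop :=
  in_d y /\ is_lim_seq (fun N => dnorm (ssub y (psum xs a N))) 0.

Definition series_conv (xs : nat -> seqR) (a : seqR) : Prop :=
  exists y, series_conv_to xs a y.

Definition in_closed_span (xs : nat -> seqR) (y : seqR) : Prop :=
  in_d y /\ forall eps, 0 < eps -> exists (c : seqR) (N : nat),
    dnorm (ssub y (psum xs c N)) < eps.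

Definition basic_seq (xs : nat -> seqR) : Prop :=
  (forall n, in_d (xs n)) /\
  forall y, in_closed_span xs y ->
    exists a, series_conv_to xs a y /\
      forall b, series_conv_to xs b y -> forall n, b n = a n.

Definition seq_equiv (xs ys : nat -> seqR) : Prop :=
  forall a, series_conv xs a <-> series_conv ys a.

Definition symmetric_basic_seq (xs : nat -> seqR) : Prop :=
  basic_seq xs /\
  forall pi : nat -> nat, (forall m n, pi m = pi n -> m = n) ->
    (forall m, exists n, pi n = m) -> seq_equiv xs (fun n => xs (pi n)).

Definition exactly_two_symmetric : Prop :=
  exists s1 s2, symmetric_basic_seq s1 /\ symmetric_basic_seq s2 /\
    ~ seq_equiv s1 s2 /\
    forall s, symmetric_basic_seq s -> seq_equiv s s1 \/ seq_equiv s s2.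

End Lorentz.

Definition lorentz_weight (w : seqR) : Prop :=
  w 0%nat = 1 /\ (forall n, w (S n) <= w n) /\ is_lim_seq w 0 /\
  is_lim_seq (sum_n w) p_infty.

(* Main.v *)
Require Import Defs.
From Stdlib Require Import Reals List Lra Lia Bool PeanoNat FunctionalExtensionality.
From Stdlib Require Import ClassicalEpsilon Classical.
From Coquelicot Require Import Coquelicot.
Open Scope R_scope.

(** If [T] is not compact, differences of points that agree on many coordinates, and whose images
    do too, give bounded [u_n] on successive blocks such that the [T u_n] are almost supported on
    these blocks and have norms bounded below. As [d] satisfies an upper p-estimate for disjoint
    vectors, [U : f_n |-> u_n] is bounded from l_p to [d]. If the sup norms of the [T u_n] stay away
    from 0, one coordinate per block gives a bounded [V] on [d] with [V T u_n ~ e_n]. If they can be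
    taken to tend to 0, deleting the largest weights hardly changes the norm of [T u_n], so
    functionals with weights living on disjoint parts of [w] give such a [V] through l_p. In both
    cases [V T U] is close to the formal identity [j], hence [A j B] is a limit of [A V T U B] and
    lies in every closed ideal containing [T]. *)

(** * Powers and finite sums *)

(** Nothing is extracted from weak compactness, since for [p = 1] it would not apply. A finite net
    for the first coordinates of [x] and of [T x] does the work for every [p]: what matters is only
    smallness on the coordinates already used, before and after [T].

    The obstacle is that [d] has no lower p-estimate: a bounded map from [d] to l_p cannot send
    [e_n] to [f_n], because [w] tends to 0. This forces the two cases. Flat images can lose finitely
    many positions of a norming arrangement, and finitely many coordinates, at little cost. What
    remains of different images lives on disjoint positions and disjoint indices, and such pieces
    glue into one partial arrangement, whose weighted sum is bounded by the norm of [d]; this is a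
    lower p-estimate. Images that are not flat only give a [V] with values in [d], which is enough
    because [U] starts from l_p.

    Strictness reuses the flat case for the identity of [d]: divergence of the weights provides flat
    normalised vectors, and the resulting [V], which passes through l_p, is a non-compact member of
    [J^j]. *)

Lemma rpow_ge0 t q : 0 <= rpow t q.
Proof.
  unfold rpow; destruct (Rle_dec t 0); [lra|]. left; apply exp_pos.
Qed.

Lemma rpow_0 q : rpow 0 q = 0.
Proof. unfold rpow; destruct (Rle_dec 0 0); lra. Qed.

Lemma rpow_pos t q : 0 < t -> rpow t q = Rpower t q.
Proof. intros; unfold rpow; destruct (Rle_dec t 0); lra. Qed.

Lemma rpow_gt0 t q : 0 < t -> 0 < rpow t q.
Proof. intros; rewrite rpow_pos by easy; apply exp_pos. Qed.

Lemma rpow_1 q : rpow 1 q = 1.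
Proof. rewrite rpow_pos by lra. unfold Rpower. rewrite ln_1, Rmult_0_r. apply exp_0. Qed.

Lemma rpow_mono q s t : 0 <= q -> s <= t -> rpow s q <= rpow t q.
Proof.
  intros Hq Hst. unfold rpow at 1. destruct (Rle_dec s 0); [apply rpow_ge0|].
  rewrite rpow_pos by lra. apply Rle_Rpower_l; lra.
Qed.

Lemma rpow_mult q s t : 0 <= s -> 0 <= t -> rpow (s * t) q = rpow s q * rpow t q.
Proof.
  intros Hs Ht.
  destruct (Req_dec s 0) as [->|]; [rewrite Rmult_0_l, !rpow_0; ring|].
  destruct (Req_dec t 0) as [->|]; [rewrite Rmult_0_r, !rpow_0; ring|].
  assert (0 < s * t) by (apply Rmult_lt_0_compat; lra).
  rewrite !rpow_pos by lra. symmetry; apply Rpower_mult_distr; lra.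
Qed.

Lemma rpow_rpow q r t : q * r = 1 -> 0 <= t -> rpow (rpow t q) r = t.
Proof.
  intros Hqr Ht. destruct (Req_dec t 0) as [->|]; [rewrite !rpow_0; ring|].
  rewrite (rpow_pos (rpow t q)) by (apply rpow_gt0; lra).
  rewrite rpow_pos by lra. rewrite Rpower_mult, Hqr. apply Rpower_1; lra.
Qed.

(* Weighting the tangent inequalities of [exp] at [q * ln z], taken at [ln z] and at [0], by [q] and [1 - q]. *)
Lemma Rpower_concave q z : 0 <= q <= 1 -> 0 < z -> Rpower z q <= q * z + (1 - q).
Proof.
  intros Hq Hz. unfold Rpower. set (a := q * ln z).
  assert (T : forall b, exp a * (1 + (b - a)) <= exp b).
  { intros b. replace (exp b) with (exp a * exp (b - a)) by (rewrite <- exp_plus; f_equal; ring).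
    apply Rmult_le_compat_l; [left; apply exp_pos|]. apply exp_ineq1_le. }
  pose proof (T (ln z)) as T1. pose proof (T 0) as T0.
  rewrite exp_ln in T1 by easy. rewrite exp_0 in T0.
  assert (E : exp a = q * (exp a * (1 + (ln z - a))) + (1 - q) * (exp a * (1 + (0 - a))))
    by (unfold a; ring).
  rewrite E.
  pose proof (Rmult_le_compat_l q _ _ (proj1 Hq) T1).
  pose proof (Rmult_le_compat_l (1 - q) _ _ ltac:(lra) T0). lra.
Qed.

(** Convexity of [t^q] in tangent form. Scaling by [s] leaves Bernoulli's inequality
    [1 + q (u - 1) <= u^q], which is concavity of the power [1/q] at the point [u^q]; the case
    [u = 0] stands apart because that bound needs a positive point. *)
Lemma rpow_tangent q s t : 1 <= q -> 0 < s -> 0 <= t ->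
  rpow s q + q * (rpow s q / s) * (t - s) <= rpow t q.
Proof.
  intros Hq Hs Ht.
  assert (Hsq := rpow_gt0 s q Hs).
  set (u := t / s). assert (Eu : t = s * u) by (unfold u; field; lra).
  assert (Hu : 0 <= u) by (apply Rmult_le_pos; [lra|left; apply Rinv_0_lt_compat; lra]).
  rewrite Eu, rpow_mult by lra.
  replace (rpow s q + q * (rpow s q / s) * (s * u - s)) with (rpow s q * (1 + q * (u - 1)))
    by (field; lra).
  apply Rmult_le_compat_l; [lra|].
  destruct (Req_dec u 0) as [->|Hu0]; [rewrite rpow_0; lra|].
  assert (Hz := rpow_gt0 u q ltac:(lra)).
  assert (Hiq : 0 < / q) by (apply Rinv_0_lt_compat; lra).
  assert (Hiq1 : / q <= 1) by (rewrite <- Rinv_1; apply Rinv_le_contravar; lra).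
  pose proof (Rpower_concave (/ q) (rpow u q) ltac:(lra) Hz) as Y.
  rewrite <- (rpow_pos (rpow u q)), rpow_rpow in Y; try lra; [|field; lra].
  apply (Rmult_le_compat_l q) in Y; [|lra].
  replace (q * (/ q * rpow u q + (1 - / q))) with (rpow u q + (q - 1)) in Y by (field; lra).
  lra.
Qed.

(** Half-open, unlike [sum_n], which has one term more: the empty sum starts the inductions, and
    [rsum f (N n)] stops exactly where a block starting at [N n] begins. *)
Fixpoint rsum (f : nat -> R) (n : nat) : R :=
  match n with O => 0 | S m => rsum f m + f m end.

Lemma rsum_sum_n f n : rsum f (S n) = sum_n f n.
Proof.
  induction n as [|n IH]; [simpl; rewrite sum_O; lra|].
  rewrite sum_Sn, <- IH. reflexivity.
Qed.

Lemma rsum_ext f g n : (forall i, (i < n)%nat -> f i = g i) -> rsum f n = rsum g n.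
Proof. induction n; intros H; simpl; [easy|]. rewrite IHn, H; auto. Qed.

Lemma rsum_le f g n : (forall i, (i < n)%nat -> f i <= g i) -> rsum f n <= rsum g n.
Proof.
  induction n; intros H; simpl; [lra|].
  apply Rplus_le_compat; [apply IHn; auto|apply H; lia].
Qed.

Lemma rsum_0 f n : (forall i, (i < n)%nat -> f i = 0) -> rsum f n = 0.
Proof. induction n; intros H; simpl; [easy|]. rewrite IHn, H; auto; lra. Qed.

Lemma rsum_ge0 f n : (forall i, (i < n)%nat -> 0 <= f i) -> 0 <= rsum f n.
Proof.
  intros H. rewrite <- (rsum_0 (fun _ => 0) n) by easy. now apply rsum_le.
Qed.

Lemma rsum_plus f g n : rsum (fun i => f i + g i) n = rsum f n + rsum g n.
Proof. induction n; simpl; [lra|rewrite IHn; lra]. Qed.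

Lemma rsum_scal a f n : rsum (fun i => a * f i) n = a * rsum f n.
Proof. induction n; simpl; [lra|rewrite IHn; lra]. Qed.

Lemma rsum_const c n : rsum (fun _ => c) n = INR n * c.
Proof. induction n; [simpl; lra|]. rewrite S_INR; simpl; rewrite IHn; lra. Qed.

Lemma rsum_swap f m n :
  rsum (fun i => rsum (fun j => f i j) n) m = rsum (fun j => rsum (fun i => f i j) m) n.
Proof.
  induction m; simpl.
  - symmetry; now apply rsum_0.
  - now rewrite IHm, <- rsum_plus.
Qed.

Lemma rsum_grow f m n : (forall i, 0 <= f i) -> (m <= n)%nat -> rsum f m <= rsum f n.
Proof.
  intros Hf Hmn. induction Hmn; simpl; [lra|]. specialize (Hf m0). lra.
Qed.

Lemma rsum_single f n k : (k < n)%nat -> (forall i, (i < n)%nat -> i <> k -> f i = 0) ->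
  rsum f n = f k.
Proof.
  induction n; intros Hk H; [lia|]. simpl.
  destruct (Nat.eq_dec k n) as [->|].
  - rewrite rsum_0; [lra|]. intros; apply H; lia.
  - rewrite IHn, (H n); auto; try lra; lia.
Qed.

(** Made for disjointly supported vectors: at a fixed coordinate at most one of them contributes. *)
Lemma rsum_eq_or_single f n :
  (forall i j, (i < n)%nat -> (j < n)%nat -> f i <> 0 -> f j <> 0 -> i = j) ->
  (forall i, (i < n)%nat -> f i = 0) \/
  exists k, (k < n)%nat /\ forall i, (i < n)%nat -> i <> k -> f i = 0.
Proof.
  intros H. destruct (classic (exists k, (k < n)%nat /\ f k <> 0)) as [(k & Hk & Hfk)|N].
  - right. exists k; split; [easy|]. intros i Hi Hik.
    apply NNPP; intros Hfi. apply Hik. now apply H.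
  - left. intros i Hi. apply NNPP; intros Hfi. apply N; eauto.
Qed.

Lemma rsum_extend f m n : (m <= n)%nat -> (forall i, (m <= i < n)%nat -> f i = 0) ->
  rsum f n = rsum f m.
Proof.
  intros Hmn; induction Hmn as [|n Hmn IH]; intros H; [easy|]. simpl.
  rewrite IH, (H n); try lra; try lia. intros; apply H; lia.
Qed.

Lemma rsum_abel (v a b : nat -> R) n :
  (forall k, v (S k) <= v k) -> (forall k, 0 <= v k) ->
  (forall m, (m <= n)%nat -> rsum a m <= rsum b m) ->
  rsum (fun k => v k * a k) n <= rsum (fun k => v k * b k) n.
Proof.
  intros Hd Hv H.
  (* Summation by parts as an induction: the surplus of the partial sums is kept with the last
     weight as a factor, and passing to the next, smaller weight only decreases it. *)
  assert (K : forall m, (m < n)%nat ->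
     v m * (rsum b (S m) - rsum a (S m)) <=
     rsum (fun k => v k * b k) (S m) - rsum (fun k => v k * a k) (S m)).
  { induction m as [|m IH]; intros Hm; [simpl; lra|].
    specialize (IH ltac:(lia)).
    assert (P := H (S m) ltac:(lia)).
    assert (Q := Rmult_le_compat_r (rsum b (S m) - rsum a (S m)) _ _ ltac:(lra) (Hd m)).
    revert IH P Q. set (sm := S m). simpl. intros. fold sm. lra. }
  destruct n as [|n]; [simpl; lra|].
  specialize (K n ltac:(lia)). specialize (H (S n) ltac:(lia)).
  assert (0 <= v n * (rsum b (S n) - rsum a (S n))) by (apply Rmult_le_pos; auto; lra).
  lra.
Qed.

Lemma Series_bounded f C : (forall n, 0 <= f n) -> (forall n, rsum f n <= C) ->
  ex_series f /\ Series f <= C.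
Proof.
  intros Hf HC.
  destruct (ex_finite_lim_seq_incr (sum_n f) C) as (l & Hl).
  { intros n. rewrite sum_Sn. unfold plus; simpl. specialize (Hf (S n)). lra. }
  { intros n. rewrite <- rsum_sum_n. apply HC. }
  assert (E : ex_series f) by (exists l; exact Hl).
  split; [easy|].
  rewrite (is_series_unique f l Hl).
  apply (is_lim_seq_le (sum_n f) (fun _ => C) l C); auto using is_lim_seq_const.
  intros n. rewrite <- rsum_sum_n. apply HC.
Qed.

Lemma rsum_le_Series f n : (forall k, 0 <= f k) -> ex_series f -> rsum f n <= Series f.
Proof.
  intros Hf (l & Hl). rewrite (is_series_unique f l Hl).
  apply (is_lim_seq_le_loc (fun _ => rsum f n) (sum_n f) (rsum f n) l); auto using is_lim_seq_const.
  exists n. intros k Hk. rewrite <- rsum_sum_n. apply rsum_grow; auto.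
Qed.

Lemma Series_tail_small f e : (forall k, 0 <= f k) -> ex_series f -> 0 < e ->
  exists N, forall n, (N <= n)%nat -> Series f - rsum f n <= e.
Proof.
  intros Hf (l & Hl) He.
  rewrite (is_series_unique f l Hl).
  destruct (proj2 (is_lim_seq_spec (sum_n f) l) Hl (mkposreal e He)) as (N & HN).
  exists (S N). intros n Hn. destruct n as [|n]; [lia|].
  rewrite rsum_sum_n. specialize (HN n ltac:(lia)). simpl in HN.
  apply Rabs_lt_between in HN. lra.
Qed.

Lemma is_lim_seq_0_intro x : (forall e, 0 < e -> exists N, forall n, (N <= n)%nat -> Rabs (x n) <= e) ->
  is_lim_seq x 0.
Proof.
  intros H. apply is_lim_seq_spec. intros e.
  destruct (H (e / 2) ltac:(destruct e; simpl; lra)) as (N & HN).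
  exists N. intros n Hn. rewrite Rminus_0_r. specialize (HN n Hn). destruct e; simpl in *; lra.
Qed.

Lemma is_lim_seq_0_elim x e : is_lim_seq x 0 -> 0 < e ->
  exists N, forall n, (N <= n)%nat -> Rabs (x n) <= e.
Proof.
  intros H He. apply is_lim_seq_spec in H. destruct (H (mkposreal e He)) as (N & HN).
  exists N. intros n Hn. specialize (HN n Hn). simpl in HN. rewrite Rminus_0_r in HN. lra.
Qed.

Lemma in_c0_bounded x : in_c0 x -> exists B, 0 <= B /\ forall k, Rabs (x k) <= B.
Proof.
  intros H. destruct (is_lim_seq_0_elim x 1 H ltac:(lra)) as (N & HN).
  exists (rsum (fun k => Rabs (x k)) N + 1).
  assert (P : forall n, 0 <= rsum (fun k => Rabs (x k)) n) by (intros; apply rsum_ge0; intros; apply Rabs_pos).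
  split; [specialize (P N); lra|]. intros k.
  destruct (Nat.le_gt_cases N k) as [Hk|Hk]; [specialize (HN k Hk); specialize (P N); lra|].
  pose proof (rsum_grow (fun k => Rabs (x k)) (S k) N ltac:(intros; apply Rabs_pos) Hk) as G.
  simpl in G. specialize (P k). lra.
Qed.

(** * The non-increasing rearrangement *)

Lemma In_le_list_max (F : list nat) k : In k F -> (k <= list_max F)%nat.
Proof.
  revert k. apply Forall_forall, list_max_le. lia.
Qed.

Lemma fresh_index (F : list nat) : exists k, ~ In k F.
Proof.
  exists (S (list_max F)). intros H. apply In_le_list_max in H. lia.
Qed.

(** Boundedness of [x] and an index outside [F] make the extended supremum finite, so [real] returns
    it and not its default value. *)
Lemma tailsup_lub x B F : (forall k, Rabs (x k) <= B) ->
  (forall k, ~ In k F -> Rabs (x k) <= tailsup x F) /\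
  (forall C, (forall k, ~ In k F -> Rabs (x k) <= C) -> tailsup x F <= C).
Proof.
  intros HB. unfold tailsup.
  set (E := fun t => exists k, ~ In k F /\ t = Rabs (x k)).
  destruct (Lub_Rbar_correct E) as (U & L).
  assert (LB : Rbar_le (Lub_Rbar E) B) by (apply L; intros t (k & _ & ->); apply HB).
  destruct (fresh_index F) as (k0 & Hk0).
  assert (GB : Rbar_le (Rabs (x k0)) (Lub_Rbar E)) by (apply U; now exists k0).
  destruct (Lub_Rbar E) as [l| |]; simpl in *; try easy.
  split.
  - intros k Hk. apply (U (Rabs (x k))). now exists k.
  - intros C HC. apply (L C). intros t (k & Hk & ->). simpl; auto.
Qed.

Lemma xstar_glb x B n : (forall k, Rabs (x k) <= B) ->
  (forall F, (length F <= n)%nat -> xstar x n <= tailsup x F) /\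
  (forall c, (forall F, (length F <= n)%nat -> c <= tailsup x F) -> c <= xstar x n).
Proof.
  intros HB. unfold xstar.
  set (E := fun r => exists F, (length F <= n)%nat /\ r = tailsup x F).
  destruct (Glb_Rbar_correct E) as (U & L).
  assert (G0 : Rbar_le 0 (Glb_Rbar E)).
  { apply L. intros r (F & _ & ->). destruct (fresh_index F) as (k & Hk).
    apply (Rle_trans _ (Rabs (x k))); [apply Rabs_pos|].
    now apply (proj1 (tailsup_lub x B F HB)). }
  assert (G1 : Rbar_le (Glb_Rbar E) (tailsup x nil)).
  { apply U. exists nil; simpl; split; [lia|easy]. }
  destruct (Glb_Rbar E) as [l| |]; simpl in *; try easy.
  split.
  - intros F HF. apply (U (tailsup x F)). now exists F.
  - intros c Hc. apply (L c). intros r (F & HF & ->). simpl; auto.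
Qed.

Lemma xstar_ge0 x n : in_c0 x -> 0 <= xstar x n.
Proof.
  intros H. destruct (in_c0_bounded x H) as (B & _ & HB).
  apply (proj2 (xstar_glb x B n HB)). intros F _.
  destruct (fresh_index F) as (k & Hk).
  apply (Rle_trans _ (Rabs (x k))); [apply Rabs_pos|].
  now apply (proj1 (tailsup_lub x B F HB)).
Qed.

Lemma xstar_le_sup x n C : (forall k, Rabs (x k) <= C) -> xstar x n <= C.
Proof.
  intros H. apply Rle_trans with (tailsup x nil).
  - apply (proj1 (xstar_glb x C n H)); simpl; lia.
  - apply (proj2 (tailsup_lub x C nil H)); auto.
Qed.

Lemma xstar_mono x y n : in_c0 y -> (forall k, Rabs (x k) <= Rabs (y k)) -> xstar x n <= xstar y n.
Proof.
  intros Hy H. destruct (in_c0_bounded y Hy) as (B & _ & HB).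
  assert (HB' : forall k, Rabs (x k) <= B) by (intros k; eapply Rle_trans; eauto).
  apply (proj2 (xstar_glb y B n HB)). intros F HF.
  apply Rle_trans with (tailsup x F); [now apply (proj1 (xstar_glb x B n HB'))|].
  apply (proj2 (tailsup_lub x B F HB')). intros k Hk.
  eapply Rle_trans; [apply H|]. now apply (proj1 (tailsup_lub y B F HB)).
Qed.

Lemma xstar_finite_supp x n F : in_c0 x -> (length F <= n)%nat ->
  (forall k, ~ In k F -> x k = 0) -> xstar x n = 0.
Proof.
  intros H HF H0. apply Rle_antisym; [|now apply xstar_ge0].
  destruct (in_c0_bounded x H) as (B & _ & HB).
  apply Rle_trans with (tailsup x F); [now apply (proj1 (xstar_glb x B n HB))|].
  apply (proj2 (tailsup_lub x B F HB)). intros k Hk. rewrite H0, Rabs_R0; [lra|easy].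
Qed.

(** The loss of a factor [s < 1] avoids any question of attainment in [xstar]; [dnorm_le] removes it
    in the end. *)
Lemma xstar_greedy x s n F : in_c0 x -> 0 < s < 1 -> (length F <= n)%nat ->
  exists k, ~ In k F /\ s * xstar x n <= Rabs (x k).
Proof.
  intros H Hs HF. destruct (in_c0_bounded x H) as (B & _ & HB).
  pose proof (xstar_ge0 x n H) as H0.
  destruct (Rle_lt_or_eq_dec _ _ H0) as [Hp|Hz].
  - apply NNPP. intros N.
    assert (L : xstar x n <= s * xstar x n).
    { apply Rle_trans with (tailsup x F); [now apply (proj1 (xstar_glb x B n HB))|].
      apply (proj2 (tailsup_lub x B F HB)). intros k Hk.
      apply Rnot_lt_le. intros G. apply N. exists k; split; [easy|lra]. }
    nra.
  - destruct (fresh_index F) as (k & Hk). exists k; split; [easy|].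
    rewrite <- Hz. pose proof (Rabs_pos (x k)); lra.
Qed.

Definition inj_upto (M : nat) (t : nat -> nat) : Prop :=
  forall i j, (i < M)%nat -> (j < M)%nat -> t i = t j -> i = j.

(** Partial injections with a boolean domain: arrangements living on different blocks can be glued
    into one. *)
Definition inj_on (G : nat -> bool) (t : nat -> nat) : Prop :=
  forall i j, G i = true -> G j = true -> t i = t j -> i = j.

Lemma xstar_greedy_enum x s M : in_c0 x -> 0 < s < 1 ->
  exists t, inj_upto M t /\ forall n, (n < M)%nat -> s * xstar x n <= Rabs (x (t n)).
Proof.
  intros H Hs. induction M as [|M (t & It & Ht)].
  - exists (fun n => n); split; [intros i j; lia|intros; lia].
  - destruct (xstar_greedy x s M (map t (seq 0 M)) H Hs) as (k & Hk & Hxk).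
    { now rewrite length_map, length_seq. }
    assert (Hk' : forall i, (i < M)%nat -> t i <> k).
    { intros i Hi E. apply Hk. rewrite <- E. apply in_map, in_seq. lia. }
    exists (fun n => if n =? M then k else t n). split.
    + intros i j Hi Hj.
      destruct (Nat.eqb_spec i M), (Nat.eqb_spec j M); intros E; subst; try easy.
      * exfalso. apply (Hk' j); [lia|easy].
      * exfalso. apply (Hk' i); [lia|easy].
      * apply It; auto; lia.
    + intros n Hn. destruct (Nat.eqb_spec n M); [now subst|]. apply Ht; lia.
Qed.

Fixpoint lsum (f : nat -> R) (F : list nat) : R :=
  match F with nil => 0 | i :: F' => f i + lsum f F' end.

Lemma lsum_app f F F' : lsum f (F ++ F') = lsum f F + lsum f F'.
Proof. induction F; simpl; [lra|rewrite IHF; lra]. Qed.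

Lemma list_argmin (f : nat -> R) F : F <> nil -> exists i, In i F /\ forall j, In j F -> f i <= f j.
Proof.
  induction F as [|a F IH]; [easy|intros _].
  destruct F as [|b F'].
  - exists a; split; [now left|]. intros j [->|[]]; lra.
  - destruct IH as (i & Hi & Hmin); [easy|].
    destruct (Rle_dec (f a) (f i)).
    + exists a; split; [now left|]. intros j [->|Hj]; [lra|]. specialize (Hmin _ Hj); lra.
    + exists i; split; [now right|]. intros j [->|Hj]; [lra|]. now apply Hmin.
Qed.

(* The least of [m+1] distinct entries is at most [xstar x m], since no [m] indices exhaust them. *)
Lemma lsum_le_xstar x q F : 0 <= q -> in_c0 x -> NoDup F ->
  lsum (fun i => rpow (Rabs (x i)) q) F <= rsum (fun k => rpow (xstar x k) q) (length F).
Proof.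
  intros Hq Hx. destruct (in_c0_bounded x Hx) as (B & _ & HB).
  remember (length F) as m eqn:Em. revert F Em.
  induction m as [|m IH]; intros F Em ND.
  - destruct F; [simpl; lra|easy].
  - destruct (list_argmin (fun i => Rabs (x i)) F) as (i & Hi & Hmin); [now destruct F|].
    destruct (in_split i F Hi) as (l1 & l2 & ->).
    rewrite length_app in Em; simpl in Em.
    specialize (IH (l1 ++ l2)). rewrite length_app in IH.
    specialize (IH ltac:(lia) (NoDup_remove_1 _ _ _ ND)).
    rewrite lsum_app in *. simpl.
    assert (L : rpow (Rabs (x i)) q <= rpow (xstar x m) q).
    { apply rpow_mono; [easy|].
      apply (proj2 (xstar_glb x B m HB)). intros G HG.
      destruct (classic (exists j, In j (l1 ++ i :: l2) /\ ~ In j G)) as [(j & Hj & HjG)|N].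
      - apply Rle_trans with (Rabs (x j)); [now apply Hmin|].
        now apply (proj1 (tailsup_lub x B G HB)).
      - exfalso.
        assert (I : incl (l1 ++ i :: l2) G).
        { intros j Hj. apply NNPP; intros HjG. apply N; eauto. }
        apply (NoDup_incl_length ND) in I. rewrite length_app in I; simpl in I. lia. }
    lra.
Qed.

Lemma lsum_map_filter f G (t : nat -> nat) M :
  lsum f (map t (filter G (seq 0 M))) = rsum (fun k => if G k then f (t k) else 0) M.
Proof.
  induction M as [|M IH]; [easy|].
  rewrite seq_S, filter_app, map_app, lsum_app, IH. simpl.
  destruct (G M); simpl; lra.
Qed.

Lemma NoDup_map_filter G (t : nat -> nat) M : inj_on G t -> NoDup (map t (filter G (seq 0 M))).
Proof.
  intros H. apply NoDup_map_NoDup_ForallPairs.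
  - intros a b Ha Hb. apply filter_In in Ha, Hb. now apply H.
  - apply NoDup_filter, seq_NoDup.
Qed.

(** * Norms of d and l_p *)

Section Norm.
Variables (w : seqR) (p : R).
Hypothesis Hp : 1 <= p.
Hypothesis Hw : lorentz_weight w.

Let Hp0 : 0 <= p.
Proof. lra. Qed.

Lemma w_ge0 k : 0 <= w k.
Proof.
  destruct Hw as (_ & Hd & Hl & _).
  assert (D : forall n, w (n + k)%nat <= w k).
  { induction n; simpl; [lra|]. specialize (Hd (n + k)%nat). lra. }
  apply (is_lim_seq_le (fun n => w (n + k)%nat) (fun _ => w k) 0 (w k)); auto using is_lim_seq_const.
  now apply (is_lim_seq_incr_n w k).
Qed.

Lemma w_le1 k : w k <= 1.
Proof.
  destruct Hw as (H0 & Hd & _). induction k; [lra|]. specialize (Hd k); lra.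
Qed.

Lemma wpow_ge0 k t : 0 <= w k * rpow t p.
Proof. apply Rmult_le_pos; [apply w_ge0|apply rpow_ge0]. Qed.

Lemma dnorm_ge0 x : 0 <= dnorm w p x.
Proof. apply rpow_ge0. Qed.

Lemma dnorm_pow x : in_d w p x ->
  rpow (dnorm w p x) p = Series (fun n => w n * rpow (xstar x n) p).
Proof.
  intros (_ & H). unfold dnorm. apply rpow_rpow; [field; lra|].
  apply Rle_trans with (rsum (fun n => w n * rpow (xstar x n) p) 0); [simpl; lra|].
  apply rsum_le_Series; [intros; apply wpow_ge0|easy].
Qed.

(** The first [m] positions select at most [m] distinct entries, whose powers sum to no more than
    those of the [m] largest; Abel summation against the decreasing weights does the rest.
    Unselected positions waste their weight, which is what later allows arrangements to have
    gaps. *)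
Lemma wsum_le_dnorm x G t M : in_d w p x -> inj_on G t ->
  rsum (fun k => if G k then w k * rpow (Rabs (x (t k))) p else 0) M <= rpow (dnorm w p x) p.
Proof.
  intros Hx HG. rewrite dnorm_pow by easy. destruct Hx as (Hc & He).
  apply Rle_trans with (rsum (fun n => w n * rpow (xstar x n) p) M).
  2: { apply rsum_le_Series; [intros; apply wpow_ge0|easy]. }
  rewrite (rsum_ext _ (fun k => w k * (if G k then rpow (Rabs (x (t k))) p else 0))).
  2: { intros i _. destruct (G i); ring. }
  apply rsum_abel; [apply Hw|apply w_ge0|].
  intros m _. rewrite <- (lsum_map_filter (fun j => rpow (Rabs (x j)) p)).
  eapply Rle_trans; [apply lsum_le_xstar; auto; now apply NoDup_map_filter|].
  apply rsum_grow; [intros; apply rpow_ge0|].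
  rewrite length_map. eapply Nat.le_trans; [apply filter_length_le|]. rewrite length_seq; lia.
Qed.

Lemma wsum_upto_le_dnorm x t M : in_d w p x -> inj_upto M t ->
  rsum (fun k => w k * rpow (Rabs (x (t k))) p) M <= rpow (dnorm w p x) p.
Proof.
  intros Hx Ht.
  rewrite (rsum_ext _ (fun k => if k <? M then w k * rpow (Rabs (x (t k))) p else 0)).
  - apply wsum_le_dnorm; [easy|]. intros i j Hi Hj. apply Nat.ltb_lt in Hi, Hj. now apply Ht.
  - intros i Hi. apply Nat.ltb_lt in Hi. now rewrite Hi.
Qed.

(** Greedy enumerations nearly realise the rearrangement. Together with [wsum_le_dnorm] this makes
    the norm a supremum over injective arrangements, the form in which most later estimates are
    done. *)
Lemma dnorm_le x C : in_c0 x -> 0 <= C ->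
  (forall t M, inj_upto M t -> rsum (fun k => w k * rpow (Rabs (x (t k))) p) M <= rpow C p) ->
  in_d w p x /\ dnorm w p x <= C.
Proof.
  intros Hx HC H.
  assert (K : forall s M, 0 < s < 1 ->
    rpow s p * rsum (fun n => w n * rpow (xstar x n) p) M <= rpow C p).
  { intros s M Hs. destruct (xstar_greedy_enum x s M Hx Hs) as (t & It & Ht).
    eapply Rle_trans; [|apply (H t M It)]. rewrite <- rsum_scal.
    apply rsum_le. intros i Hi.
    rewrite <- Rmult_assoc, (Rmult_comm _ (w i)), Rmult_assoc, <- rpow_mult;
      [|lra|now apply xstar_ge0].
    apply Rmult_le_compat_l; [apply w_ge0|]. apply rpow_mono; auto. }
  assert (L : forall M, rsum (fun n => w n * rpow (xstar x n) p) M <= rpow C p).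
  { intros M. set (S := rsum _ M) in *.
    assert (S0 : 0 <= S) by (apply rsum_ge0; intros; apply wpow_ge0).
    apply Rnot_lt_le. intros HS.
    assert (HCp := rpow_ge0 C p).
    (* If [S > C^p], this midpoint lies strictly between [C^p / S] and 1, and [K] for [s = r^(1/p)]
       gives [r S <= C^p], a contradiction. *)
    set (r := (rpow C p / S + 1) / 2).
    assert (Hr : rpow C p / S < 1) by (apply Rmult_lt_reg_r with S; [lra|]; field_simplify; lra).
    assert (Hr0 : 0 <= rpow C p / S) by (apply Rmult_le_pos; [lra|left; apply Rinv_0_lt_compat; lra]).
    assert (Hr1 : 0 < r < 1) by (unfold r; lra).
    set (s := rpow r (1 / p)).
    assert (Es : rpow s p = r) by (apply rpow_rpow; [field; lra|lra]).
    assert (Hs : 0 < s < 1).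
    { split; [apply rpow_gt0; lra|]. apply Rnot_le_lt; intros G.
      apply (rpow_mono p) in G; [|lra]. rewrite rpow_1, Es in G. lra. }
    specialize (K s M Hs). fold S in K. rewrite Es in K.
    assert (rpow C p / S * S = rpow C p) by (field; lra).
    unfold r in K. nra. }
  destruct (Series_bounded (fun n => w n * rpow (xstar x n) p) (rpow C p)) as (E & B);
    [intros; apply wpow_ge0|exact L|].
  split; [now split|].
  unfold dnorm. rewrite <- (rpow_rpow p (1 / p) C) by (try lra; field; lra).
  apply rpow_mono; [|easy]. left. apply Rdiv_lt_0_compat; lra.
Qed.

Lemma dnorm_gt_witness x C : in_d w p x -> 0 <= C -> C < dnorm w p x ->
  exists t M, inj_upto M t /\ rpow C p < rsum (fun k => w k * rpow (Rabs (x (t k))) p) M.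
Proof.
  intros Hx HC HlC. apply NNPP. intros N.
  destruct (dnorm_le x C) as (_ & B); [apply Hx|easy| |lra].
  intros t M Ht. apply Rnot_lt_le. intros G. apply N. eauto.
Qed.

Lemma rpow_le_reg s t : 0 <= t -> rpow s p <= rpow t p -> s <= t.
Proof.
  intros Ht H. destruct (Rle_dec s 0); [lra|].
  rewrite <- (rpow_rpow p (1 / p) s), <- (rpow_rpow p (1 / p) t); try lra; try (field; lra).
  apply rpow_mono; [|easy]. left. apply Rdiv_lt_0_compat; lra.
Qed.

Lemma abs_le_dnorm x k : in_d w p x -> Rabs (x k) <= dnorm w p x.
Proof.
  intros Hx. apply rpow_le_reg; [apply dnorm_ge0|].
  eapply Rle_trans; [|apply (wsum_upto_le_dnorm x (fun _ => k) 1 Hx)].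
  - simpl. rewrite (proj1 Hw). lra.
  - intros i j; lia.
Qed.

Lemma dnorm_mono x y C : 0 <= C -> in_d w p y -> (forall k, Rabs (x k) <= C * Rabs (y k)) ->
  in_d w p x /\ dnorm w p x <= C * dnorm w p y.
Proof.
  intros HC Hy H. apply dnorm_le.
  - apply is_lim_seq_0_intro. intros e He.
    destruct (is_lim_seq_0_elim y (e / (C + 1)) (proj1 Hy)) as (N & HN).
    { apply Rdiv_lt_0_compat; lra. }
    exists N. intros n Hn. eapply Rle_trans; [apply H|]. specialize (HN n Hn).
    assert (E : (C + 1) * (e / (C + 1)) = e) by (field; lra).
    pose proof (Rabs_pos (y n)). nra.
  - apply Rmult_le_pos; [easy|apply dnorm_ge0].
  - intros t M Ht. rewrite rpow_mult by (auto; apply dnorm_ge0).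
    eapply Rle_trans; [|apply Rmult_le_compat_l; [apply rpow_ge0|apply (wsum_upto_le_dnorm y t M Hy Ht)]].
    rewrite <- rsum_scal. apply rsum_le. intros i _.
    rewrite <- Rmult_assoc, (Rmult_comm _ (w i)), Rmult_assoc, <- rpow_mult; auto using Rabs_pos.
    apply Rmult_le_compat_l; [apply w_ge0|]. apply rpow_mono; auto.
Qed.

Lemma dnorm_sscale c x : in_d w p x ->
  in_d w p (sscale c x) /\ dnorm w p (sscale c x) <= Rabs c * dnorm w p x.
Proof.
  intros Hx. apply dnorm_mono; auto using Rabs_pos.
  intros k. unfold sscale. rewrite Rabs_mult. lra.
Qed.

Lemma rpow_convex l s t : 0 <= l <= 1 -> 0 <= s -> 0 <= t ->
  rpow (l * s + (1 - l) * t) p <= l * rpow s p + (1 - l) * rpow t p.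
Proof.
  intros Hl Hs Ht. set (m := l * s + (1 - l) * t).
  assert (Hm : 0 <= m) by (unfold m; nra).
  assert (P := rpow_ge0 s p). assert (Q := rpow_ge0 t p).
  destruct (Req_dec m 0) as [->|Hm0]; [rewrite rpow_0; nra|].
  pose proof (rpow_tangent p m s Hp ltac:(lra) Hs) as Ts.
  pose proof (rpow_tangent p m t Hp ltac:(lra) Ht) as Tt.
  apply (Rmult_le_compat_l l) in Ts; [|lra].
  apply (Rmult_le_compat_l (1 - l)) in Tt; [|lra].
  set (c := p * (rpow m p / m)) in *.
  assert (E : l * (rpow m p + c * (s - m)) + (1 - l) * (rpow m p + c * (t - m)) = rpow m p)
    by (unfold m at 2 4; ring).
  lra.
Qed.

(** The tangent at the mean [m], averaged with the weights [th]: its linear terms cancel since the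
    weights sum to 1. *)
Lemma rpow_jensen (G : nat -> bool) (th s : nat -> R) M :
  (forall k, 0 <= th k) -> (forall k, 0 <= s k) ->
  rsum (fun k => if G k then th k else 0) M = 1 ->
  rpow (rsum (fun k => if G k then th k * s k else 0) M) p <=
  rsum (fun k => if G k then th k * rpow (s k) p else 0) M.
Proof.
  intros Hth Hs H1. set (m := rsum (fun k => if G k then th k * s k else 0) M).
  assert (Hm : 0 <= m).
  { apply rsum_ge0. intros i _. destruct (G i); [apply Rmult_le_pos; auto|lra]. }
  destruct (Req_dec m 0) as [->|Hm0].
  { rewrite rpow_0. apply rsum_ge0. intros i _.
    destruct (G i); [apply Rmult_le_pos; auto using rpow_ge0|lra]. }
  set (c := p * (rpow m p / m)).
  apply Rle_trans with
    (rsum (fun k => (rpow m p - c * m) * (if G k then th k else 0) + c * (if G k then th k * s k else 0)) M).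
  - rewrite rsum_plus, !rsum_scal, H1. fold m. lra.
  - apply rsum_le. intros i _. destruct (G i); [|lra].
    pose proof (rpow_tangent p m (s i) Hp ltac:(lra) (Hs i)) as T. fold c in T.
    apply (Rmult_le_compat_l (th i)) in T; auto. lra.
Qed.

Lemma in_c0_add x y : in_c0 x -> in_c0 y -> in_c0 (sadd x y).
Proof.
  intros Hx Hy. unfold in_c0, sadd. replace 0 with (0 + 0) by ring.
  now apply is_lim_seq_plus'.
Qed.

(* Convexity at the weights [X/(X+Y)], [Y/(X+Y)] with [X], [Y] the two norms gives Minkowski's inequality. *)
Lemma dnorm_sadd x y : in_d w p x -> in_d w p y ->
  in_d w p (sadd x y) /\ dnorm w p (sadd x y) <= dnorm w p x + dnorm w p y.
Proof.
  intros Hx Hy.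
  assert (K : forall X Y, 0 < X -> 0 < Y -> dnorm w p x <= X -> dnorm w p y <= Y ->
    in_d w p (sadd x y) /\ dnorm w p (sadd x y) <= X + Y).
  { intros X Y HX HY HxX HyY. apply dnorm_le; [apply in_c0_add; [apply Hx|apply Hy]|lra|].
    intros t M Ht. set (l := X / (X + Y)).
    assert (El : 1 - l = Y / (X + Y)) by (unfold l; field; lra).
    assert (Hl : 0 < l) by (apply Rdiv_lt_0_compat; lra).
    assert (Hl' : 0 < 1 - l) by (rewrite El; apply Rdiv_lt_0_compat; lra).
    assert (HZ : 0 < X + Y) by lra.
    set (g := fun z s => rsum (fun k => w k * rpow (Rabs (z (t k)) / s) p) M).
    assert (Eg : forall z s, 0 < s -> in_d w p z -> dnorm w p z <= s -> g z s <= 1).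
    { intros z s Hs Hz Hzs.
      assert (Hsp := rpow_gt0 s p Hs).
      apply Rmult_le_reg_l with (rpow s p); [easy|]. unfold g. rewrite <- rsum_scal, Rmult_1_r.
      apply Rle_trans with (rpow (dnorm w p z) p); [|apply rpow_mono; lra].
      eapply Rle_trans; [|apply (wsum_upto_le_dnorm z t M Hz Ht)]. apply Req_le, rsum_ext.
      intros i _. rewrite <- Rmult_assoc, (Rmult_comm _ (w i)), Rmult_assoc, <- rpow_mult; try lra.
      - do 2 f_equal. field; lra.
      - apply Rmult_le_pos; [apply Rabs_pos|left; now apply Rinv_0_lt_compat]. }
    apply Rle_trans with (rpow (X + Y) p * (l * g x X + (1 - l) * g y Y)).
    2: { rewrite <- (Rmult_1_r (rpow (X + Y) p)) at 2.
         apply Rmult_le_compat_l; [apply rpow_ge0|].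
         pose proof (Eg x X HX Hx HxX). pose proof (Eg y Y HY Hy HyY). nra. }
    unfold g. rewrite <- !rsum_scal, <- rsum_plus, <- rsum_scal. apply rsum_le. intros i _.
    set (a := Rabs (x (t i))). set (b := Rabs (y (t i))).
    assert (Ha : 0 <= a) by apply Rabs_pos. assert (Hb : 0 <= b) by apply Rabs_pos.
    assert (C : rpow (Rabs (sadd x y (t i))) p <= rpow (X + Y) p * (l * rpow (a / X) p + (1 - l) * rpow (b / Y) p)).
    { apply Rle_trans with (rpow ((X + Y) * (l * (a / X) + (1 - l) * (b / Y))) p).
      - apply rpow_mono; [easy|].
        replace ((X + Y) * (l * (a / X) + (1 - l) * (b / Y))) with (a + b)
          by (rewrite El; unfold l; field; lra).
        apply Rabs_triang.
      - assert (0 <= a / X) by (apply Rmult_le_pos; [easy|left; now apply Rinv_0_lt_compat]).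
        assert (0 <= b / Y) by (apply Rmult_le_pos; [easy|left; now apply Rinv_0_lt_compat]).
        rewrite rpow_mult; [|lra|nra].
        apply Rmult_le_compat_l; [apply rpow_ge0|]. apply rpow_convex; lra. }
    apply (Rmult_le_compat_l (w i)) in C; [|apply w_ge0]. lra. }
  pose proof (dnorm_ge0 x). pose proof (dnorm_ge0 y).
  split; [apply (K (dnorm w p x + 1) (dnorm w p y + 1)); lra|].
  (* [K] needs strictly positive bounds; the added [e / 2] covers vectors of norm 0. *)
  apply le_epsilon. intros e He.
  destruct (K (dnorm w p x + e / 2) (dnorm w p y + e / 2)) as (_ & ?); lra.
Qed.

(** * Restrictions, unit vectors and tails in d *)

Definition restr (P : nat -> bool) (x : seqR) : seqR := fun k => if P k then x k else 0.
Definition below (N k : nat) : bool := k <? N.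
Definition from (N k : nat) : bool := N <=? k.
Definition unit_seq (n : nat) : seqR := fun k => if k =? n then 1 else 0.

Lemma dnorm_restr P x : in_d w p x ->
  in_d w p (restr P x) /\ dnorm w p (restr P x) <= dnorm w p x.
Proof.
  intros Hx. rewrite <- (Rmult_1_l (dnorm w p x)). apply dnorm_mono; [lra|easy|].
  intros k. unfold restr. destruct (P k); [lra|]. rewrite Rabs_R0. pose proof (Rabs_pos (x k)); lra.
Qed.

Lemma restr_lin P x y s t :
  restr P (sadd (sscale s x) (sscale t y)) = sadd (sscale s (restr P x)) (sscale t (restr P y)).
Proof.
  apply functional_extensionality; intros k. unfold restr, sadd, sscale. destruct (P k); ring.
Qed.

Lemma dnorm_zero : in_d w p (fun _ => 0) /\ dnorm w p (fun _ => 0) <= 0.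
Proof.
  apply dnorm_le; [apply is_lim_seq_const|lra|]. intros t M _.
  rewrite rsum_0; [apply rpow_ge0|]. intros. rewrite Rabs_R0, rpow_0. ring.
Qed.

Lemma dnorm_unit n : in_d w p (unit_seq n) /\ dnorm w p (unit_seq n) <= 1.
Proof.
  apply dnorm_le; [|lra|].
  - apply is_lim_seq_0_intro. intros e He. exists (S n). intros k Hk. unfold unit_seq.
    destruct (Nat.eqb_spec k n); [lia|]. rewrite Rabs_R0; lra.
  - intros t M Ht. rewrite rpow_1.
    destruct (rsum_eq_or_single (fun k => w k * rpow (Rabs (unit_seq n (t k))) p) M) as [Z|(k & Hk & Z)].
    + assert (V : forall i, w i * rpow (Rabs (unit_seq n (t i))) p <> 0 -> t i = n).
      { intros i Hi. unfold unit_seq in Hi. destruct (Nat.eqb_spec (t i) n); [easy|].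
        rewrite Rabs_R0, rpow_0, Rmult_0_r in Hi. easy. }
      intros i j Hi Hj Vi Vj. apply Ht; auto. now rewrite (V i), (V j).
    + rewrite rsum_0; [lra|easy].
    + rewrite (rsum_single _ M k Hk Z). unfold unit_seq.
      pose proof (w_le1 k). pose proof (w_ge0 k).
      destruct (t k =? n); rewrite ?Rabs_R1, ?Rabs_R0, ?rpow_1, ?rpow_0; lra.
Qed.

Lemma ssub_lin x y : ssub x y = sadd (sscale 1 x) (sscale (-1) y).
Proof. apply functional_extensionality; intros k; unfold ssub, sadd, sscale; ring. Qed.

Lemma in_d_lin a b x y : in_d w p x -> in_d w p y -> in_d w p (sadd (sscale a x) (sscale b y)).
Proof. intros Hx Hy. apply dnorm_sadd; now apply dnorm_sscale. Qed.

Lemma dnorm_ssub x y : in_d w p x -> in_d w p y ->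
  in_d w p (ssub x y) /\ dnorm w p (ssub x y) <= dnorm w p x + dnorm w p y.
Proof.
  intros Hx Hy. rewrite ssub_lin. split; [now apply in_d_lin|].
  destruct (dnorm_sscale 1 x Hx) as (H1 & N1). destruct (dnorm_sscale (-1) y Hy) as (H2 & N2).
  destruct (dnorm_sadd _ _ H1 H2) as (_ & N3).
  rewrite Rabs_R1 in N1. rewrite Rabs_left in N2 by lra. lra.
Qed.

Lemma dnorm_le_ssub x y : in_d w p x -> in_d w p y ->
  dnorm w p x <= dnorm w p y + dnorm w p (ssub x y).
Proof.
  intros Hx Hy. replace (dnorm w p x) with (dnorm w p (sadd y (ssub x y))).
  - apply dnorm_sadd; [easy|]. now apply dnorm_ssub.
  - f_equal. apply functional_extensionality; intros k; unfold ssub, sadd; ring.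
Qed.

Lemma dnorm_rsum (f : nat -> seqR) (c : nat -> R) n :
  (forall i, (i < n)%nat -> in_d w p (f i) /\ dnorm w p (f i) <= c i) ->
  in_d w p (fun k => rsum (fun i => f i k) n) /\
  dnorm w p (fun k => rsum (fun i => f i k) n) <= rsum c n.
Proof.
  induction n as [|n IH]; intros H; [apply dnorm_zero|].
  destruct IH as (I1 & N1); [auto|]. destruct (H n) as (I2 & N2); [lia|].
  destruct (dnorm_sadd _ _ I1 I2) as (I3 & N3). unfold sadd in *. simpl. split; [easy|lra].
Qed.

Lemma restr_below_sum N x : restr (below N) x = fun k => rsum (fun i => sscale (x i) (unit_seq i) k) N.
Proof.
  apply functional_extensionality; intros k. unfold restr, below, sscale, unit_seq.
  destruct (Nat.ltb_spec k N) as [Hk|Hk].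
  - rewrite (rsum_single _ N k Hk).
    + rewrite Nat.eqb_refl; ring.
    + intros i _ Hi. destruct (Nat.eqb_spec k i); [congruence|ring].
  - rewrite rsum_0; [easy|]. intros i Hi. destruct (Nat.eqb_spec k i); [lia|ring].
Qed.

Lemma dnorm_below N x e : (forall i, (i < N)%nat -> Rabs (x i) <= e) ->
  in_d w p (restr (below N) x) /\ dnorm w p (restr (below N) x) <= INR N * e.
Proof.
  intros H. rewrite restr_below_sum, <- rsum_const. apply dnorm_rsum. intros i Hi.
  destruct (dnorm_unit i) as (I & B). destruct (dnorm_sscale (x i) _ I) as (I' & B').
  split; [easy|]. eapply Rle_trans; [exact B'|]. rewrite <- (Rmult_1_r e).
  apply Rmult_le_compat; auto using Rabs_pos, dnorm_ge0.
Qed.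

(** Dominated convergence by hand. The rearrangement of a tail lies below that of [x], whose terms
    beyond some [M] contribute at most [e^p / 2]; it also lies below the sup norm of the tail, and
    once this is at most [c] the first [M] terms contribute at most [e^p / 2]. *)
Lemma dnorm_from_small x e : in_d w p x -> 0 < e ->
  exists N0, forall N, (N0 <= N)%nat -> dnorm w p (restr (from N) x) <= e.
Proof.
  intros Hx He. set (f := fun n => w n * rpow (xstar x n) p).
  assert (Hep := rpow_gt0 e p He).
  destruct (Series_tail_small f (rpow e p / 2)) as (M & HM);
    [intros; apply wpow_ge0|apply Hx|lra|]. specialize (HM M (Nat.le_refl M)).
  pose proof (pos_INR M) as HMp.
  set (q := rpow e p / 2 / (INR M + 1)).
  assert (Hq : 0 < q) by (repeat apply Rdiv_lt_0_compat; lra).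
  set (c := rpow q (1 / p)).
  assert (Hc : 0 < c) by now apply rpow_gt0.
  assert (Ec : rpow c p = q) by (apply rpow_rpow; [field; lra|lra]).
  destruct (is_lim_seq_0_elim x c (proj1 Hx) Hc) as (N0 & HN0).
  exists N0. intros N HN. set (y := restr (from N) x).
  destruct (dnorm_restr (from N) x Hx) as (Hy & _). fold y in Hy.
  assert (L1 : forall n, xstar y n <= xstar x n).
  { intros n. apply xstar_mono; [apply Hx|]. intros k. unfold y, restr.
    destruct (from N k); [lra|]. rewrite Rabs_R0. apply Rabs_pos. }
  assert (L2 : forall n, xstar y n <= c).
  { intros n. apply xstar_le_sup. intros k. unfold y, restr, from.
    destruct (Nat.leb_spec N k); [apply HN0; lia|]. rewrite Rabs_R0; lra. }
  apply rpow_le_reg; [lra|]. rewrite dnorm_pow by easy.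
  set (g := fun n => w n * rpow (xstar y n) p).
  assert (g0 : forall n, 0 <= g n) by (intros; apply wpow_ge0).
  assert (gf : forall n, g n <= f n).
  { intros n. apply Rmult_le_compat_l; [apply w_ge0|]. apply rpow_mono; auto. }
  apply Series_bounded; [exact g0|]. intros n.
  apply Rle_trans with (rsum g (M + n)); [apply rsum_grow; [exact g0|lia]|].
  assert (K : rsum g (M + n) <= INR M * q + (rsum f (M + n) - rsum f M)).
  { induction n as [|n IH].
    - rewrite Nat.add_0_r, <- rsum_const.
      assert (rsum g M <= rsum (fun _ => q) M); [|lra].
      apply rsum_le. intros i _. unfold g. rewrite <- Ec.
      pose proof (rpow_mono p _ _ Hp0 (L2 i)). pose proof (rpow_ge0 (xstar y i) p).
      pose proof (w_le1 i). pose proof (w_ge0 i). nra.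
    - rewrite Nat.add_succ_r. simpl. specialize (gf (M + n)%nat). lra. }
  assert (rsum f (M + n) <= Series f) by (apply rsum_le_Series; [intros; apply wpow_ge0|apply Hx]).
  assert (INR M * q <= rpow e p / 2).
  { replace (rpow e p / 2) with ((INR M + 1) * q) by (unfold q; field; lra). nra. }
  lra.
Qed.

(** * The space l_p and its maps into d *)

Lemma lpnorm_ge0 a : 0 <= lpnorm p a.
Proof. apply rpow_ge0. Qed.

Lemma lp_rsum_le a n : in_lp p a -> rsum (fun k => rpow (Rabs (a k)) p) n <= rpow (lpnorm p a) p.
Proof.
  intros H. unfold lpnorm.
  assert (P : forall n, rsum (fun k => rpow (Rabs (a k)) p) n <= Series (fun k => rpow (Rabs (a k)) p)).
  { intros m. apply (rsum_le_Series (fun k => rpow (Rabs (a k)) p)); [intros; apply rpow_ge0|easy]. }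
  rewrite rpow_rpow; [apply P|field; lra|apply (P 0%nat)].
Qed.

Lemma lpnorm_le a C : 0 <= C -> (forall n, rsum (fun k => rpow (Rabs (a k)) p) n <= rpow C p) ->
  in_lp p a /\ lpnorm p a <= C.
Proof.
  intros HC H.
  destruct (Series_bounded (fun k => rpow (Rabs (a k)) p) (rpow C p)) as (E & B);
    [intros; apply rpow_ge0|exact H|].
  split; [easy|]. unfold lpnorm. rewrite <- (rpow_rpow p (1 / p) C) by (try lra; field; lra).
  apply rpow_mono; [|easy]. left. apply Rdiv_lt_0_compat; lra.
Qed.

Lemma abs_le_lpnorm a n : in_lp p a -> Rabs (a n) <= lpnorm p a.
Proof.
  intros H. apply rpow_le_reg; [apply lpnorm_ge0|].
  eapply Rle_trans; [|apply (lp_rsum_le a (S n) H)]. simpl.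
  assert (0 <= rsum (fun k => rpow (Rabs (a k)) p) n); [|lra].
  apply rsum_ge0. intros; apply rpow_ge0.
Qed.

Lemma lp_from_small a e : in_lp p a -> 0 < e ->
  exists N, in_lp p (restr (from N) a) /\ lpnorm p (restr (from N) a) <= e.
Proof.
  intros Ha He. set (f := fun k => rpow (Rabs (a k)) p).
  destruct (Series_tail_small f (rpow e p)) as (N & HN);
    [intros; apply rpow_ge0|exact Ha|now apply rpow_gt0|]. specialize (HN N (Nat.le_refl N)).
  exists N. apply lpnorm_le; [lra|]. intros n.
  set (g := fun k => rpow (Rabs (restr (from N) a k)) p).
  apply Rle_trans with (rsum g (N + n)); [apply rsum_grow; [intros; apply rpow_ge0|lia]|].
  assert (K : rsum g (N + n) = rsum f (N + n) - rsum f N).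
  { induction n as [|n IH].
    - rewrite Nat.add_0_r, rsum_0; [lra|]. intros i Hi. unfold g, restr, from.
      destruct (Nat.leb_spec N i); [lia|]. now rewrite Rabs_R0, rpow_0.
    - rewrite Nat.add_succ_r. simpl. rewrite IH. unfold g at 1, restr, from.
      destruct (Nat.leb_spec N (N + n)); [|lia]. fold (f (N + n)%nat). lra. }
  rewrite K.
  assert (rsum f (N + n) <= Series f) by (apply rsum_le_Series; [intros; apply rpow_ge0|exact Ha]).
  lra.
Qed.

Lemma lp_c0 a : in_lp p a -> in_c0 a.
Proof.
  intros Ha. apply is_lim_seq_0_intro. intros e He.
  destruct (lp_from_small a e Ha He) as (N & HN & B). exists N. intros n Hn.
  eapply Rle_trans; [|exact B].
  replace (a n) with (restr (from N) a n); [now apply abs_le_lpnorm|].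
  unfold restr, from. destruct (Nat.leb_spec N n); [easy|lia].
Qed.

Lemma lp_finite_support a N : (forall k, (N <= k)%nat -> a k = 0) -> in_lp p a.
Proof.
  intros H. set (f := fun k => rpow (Rabs (a k)) p).
  apply (Series_bounded f (rsum f N)); [intros; apply rpow_ge0|]. intros n.
  apply Rle_trans with (rsum f (N + n)); [apply rsum_grow; [intros; apply rpow_ge0|lia]|].
  apply Req_le, rsum_extend; [lia|]. intros i Hi. unfold f. rewrite H by lia. now rewrite Rabs_R0, rpow_0.
Qed.

(* [U a = sum_n a_n u_n]; the cut at [S k] loses nothing as soon as [u_n] is supported in [[n, oo)]. *)
Definition synth (u : nat -> seqR) (a : seqR) : seqR := fun k => rsum (fun n => a n * u n k) (S k).

Lemma rpow_rsum_disjoint b n :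
  (forall i j, (i < n)%nat -> (j < n)%nat -> b i <> 0 -> b j <> 0 -> i = j) ->
  rpow (Rabs (rsum b n)) p <= rsum (fun i => rpow (Rabs (b i)) p) n.
Proof.
  intros H. destruct (rsum_eq_or_single b n H) as [Z|(k & Hk & Z)].
  - rewrite rsum_0, Rabs_R0, rpow_0 by easy. apply rsum_ge0. intros; apply rpow_ge0.
  - rewrite (rsum_single b n k Hk Z).
    rewrite (rsum_single (fun i => rpow (Rabs (b i)) p) n k Hk); [lra|].
    intros i Hi Hik. now rewrite Z, Rabs_R0, rpow_0.
Qed.

Lemma incr_bound (N : nat -> nat) : (forall n, (N n < N (S n))%nat) ->
  (forall n, (n <= N n)%nat) /\ (forall m n, (m <= n)%nat -> (N m <= N n)%nat).
Proof.
  intros H. split.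
  - induction n; [lia|]. specialize (H n); lia.
  - intros m n Hmn. induction Hmn; [lia|]. specialize (H m0); lia.
Qed.

Lemma block_unique (N : nat -> nat) m n k : (forall n, (N n < N (S n))%nat) ->
  (N m <= k < N (S m))%nat -> (N n <= k < N (S n))%nat -> m = n.
Proof.
  intros H Hm Hn. destruct (incr_bound N H) as (_ & I).
  destruct (Nat.lt_trichotomy m n) as [L|[E|L]]; [|easy|].
  - specialize (I (S m) n L). lia.
  - specialize (I (S n) m L). lia.
Qed.

(** The upper p-estimate for disjoint vectors. Along an arrangement [t], each coordinate sees at
    most one [u n], so the power of the sum splits into a sum over [n]; after exchanging the sums,
    [t] is an arrangement of each [u n] separately and contributes at most [r^p]. *)
Lemma dnorm_synth (N : nat -> nat) u r a :
  (forall n, (N n < N (S n))%nat) ->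
  (forall n k, u n k <> 0 -> (N n <= k < N (S n))%nat) ->
  (forall n, in_d w p (u n) /\ dnorm w p (u n) <= r) -> 0 <= r -> in_lp p a ->
  in_d w p (synth u a) /\ dnorm w p (synth u a) <= r * lpnorm p a.
Proof.
  intros HN Hs Hu Hr Ha.
  destruct (incr_bound N HN) as (IB & IM).
  assert (D : forall k i j, a i * u i k <> 0 -> a j * u j k <> 0 -> i = j).
  { intros k i j Hi Hj. apply (block_unique N i j k HN); apply Hs; intros E;
      rewrite E, Rmult_0_r in *; easy. }
  assert (EX : forall k m, (k < m)%nat -> synth u a k = rsum (fun n => a n * u n k) m).
  { intros k m Hkm. unfold synth. symmetry. apply rsum_extend; [lia|].
    intros i Hi. destruct (Req_dec (u i k) 0) as [->|Hne]; [ring|].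
    apply Hs in Hne. specialize (IB i). lia. }
  apply dnorm_le.
  - apply is_lim_seq_0_intro. intros e He.
    destruct (is_lim_seq_0_elim a (e / (r + 1)) (lp_c0 a Ha)) as (n0 & Hn0).
    { apply Rdiv_lt_0_compat; lra. }
    exists (N n0). intros k Hk. unfold synth.
    destruct (rsum_eq_or_single (fun n => a n * u n k) (S k)) as [Z|(i & Hi & Z)].
    { intros i j _ _. apply D. }
    { rewrite rsum_0, Rabs_R0 by easy. lra. }
    rewrite (rsum_single (fun n => a n * u n k) (S k) i Hi Z).
    destruct (Req_dec (u i k) 0) as [->|Hne]; [rewrite Rmult_0_r, Rabs_R0; lra|].
    apply Hs in Hne.
    assert (n0 <= i)%nat.
    { destruct (Nat.le_gt_cases n0 i) as [?|L]; [easy|]. specialize (IM (S i) n0 L). lia. }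
    rewrite Rabs_mult. specialize (Hn0 i H).
    pose proof (abs_le_dnorm (u i) k (proj1 (Hu i))) as A. destruct (Hu i) as (_ & B).
    assert (E : e / (r + 1) * (r + 1) = e) by (field; lra).
    pose proof (Rabs_pos (a i)). pose proof (Rabs_pos (u i k)). nra.
  - apply Rmult_le_pos; [easy|apply lpnorm_ge0].
  - intros t M Ht.
    (* All coordinates read by the arrangement lie below [K], so the varying cuts in [synth] can be
       replaced by this common one. *)
    set (K := S (list_max (map t (seq 0 M)))).
    assert (HK : forall i, (i < M)%nat -> (t i < K)%nat).
    { intros i Hi. apply Nat.lt_succ_r, In_le_list_max, in_map, in_seq. lia. }
    apply Rle_trans with
      (rsum (fun k => rsum (fun n => rpow (Rabs (a n)) p * (w k * rpow (Rabs (u n (t k))) p)) K) M).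
    + apply rsum_le. intros k Hk. rewrite (EX (t k) K (HK k Hk)).
      rewrite (rsum_ext (fun n => rpow (Rabs (a n)) p * (w k * rpow (Rabs (u n (t k))) p))
                        (fun n => w k * rpow (Rabs (a n * u n (t k))) p)).
      * rewrite rsum_scal. apply Rmult_le_compat_l; [apply w_ge0|].
        apply rpow_rsum_disjoint. intros i j _ _. apply D.
      * intros n _. rewrite Rabs_mult, rpow_mult by apply Rabs_pos. ring.
    + rewrite rsum_swap, rpow_mult by (auto; apply lpnorm_ge0).
      apply Rle_trans with (rsum (fun n => rpow r p * rpow (Rabs (a n)) p) K).
      * apply rsum_le. intros n _. rewrite rsum_scal, Rmult_comm.
        apply Rmult_le_compat_r; [apply rpow_ge0|].
        destruct (Hu n) as (I & B).
        eapply Rle_trans; [apply (wsum_upto_le_dnorm (u n) t M I Ht)|]. apply rpow_mono; auto.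
      * rewrite rsum_scal. apply Rmult_le_compat_l; [apply rpow_ge0|]. now apply lp_rsum_le.
Qed.

(** Boundedness of the formal identity [j], which is invisible in terms because both spaces consist
    of plain sequences. *)
Lemma lp_in_d a : in_lp p a -> in_d w p a /\ dnorm w p a <= lpnorm p a.
Proof.
  intros Ha. assert (E : synth unit_seq a = a).
  { apply functional_extensionality; intros k. unfold synth.
    rewrite (rsum_single _ (S k) k); [|lia|].
    - unfold unit_seq. rewrite Nat.eqb_refl; ring.
    - intros i _ Hi. unfold unit_seq. destruct (Nat.eqb_spec k i); [congruence|ring]. }
  rewrite <- E at 1 2. rewrite <- (Rmult_1_l (lpnorm p a)).
  apply (dnorm_synth (fun n => n)); auto using dnorm_unit; try lra.
  intros n k Hk. unfold unit_seq in Hk. destruct (Nat.eqb_spec k n); [lia|easy].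
Qed.

Lemma lpnorm_unit n : in_lp p (unit_seq n) /\ lpnorm p (unit_seq n) <= 1.
Proof.
  apply lpnorm_le; [lra|]. intros m. rewrite rpow_1.
  assert (G : rsum (fun k => rpow (Rabs (unit_seq n k)) p) (S (n + m)) = 1).
  { rewrite (rsum_single _ _ n); [|lia|].
    - unfold unit_seq. now rewrite Nat.eqb_refl, Rabs_R1, rpow_1.
    - intros i _ Hi. unfold unit_seq. destruct (Nat.eqb_spec i n); [easy|]. now rewrite Rabs_R0, rpow_0. }
  rewrite <- G. apply rsum_grow; [intros; apply rpow_ge0|lia].
Qed.

Lemma synth_unit u n : (forall k, (k < n)%nat -> u n k = 0) -> synth u (unit_seq n) = u n.
Proof.
  intros H. apply functional_extensionality; intros k. unfold synth.
  destruct (Nat.lt_ge_cases k n) as [L|L].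
  - rewrite rsum_0; [now rewrite H|]. intros i Hi. unfold unit_seq.
    destruct (Nat.eqb_spec i n); [lia|ring].
  - rewrite (rsum_single _ (S k) n); [|lia|].
    + unfold unit_seq. rewrite Nat.eqb_refl; ring.
    + intros i _ Hi. unfold unit_seq. destruct (Nat.eqb_spec i n); [easy|ring].
Qed.

Lemma synth_lin u a b s t :
  synth u (sadd (sscale s a) (sscale t b)) = sadd (sscale s (synth u a)) (sscale t (synth u b)).
Proof.
  apply functional_extensionality; intros k. unfold synth, sadd, sscale.
  rewrite <- !rsum_scal, <- rsum_plus. apply rsum_ext. intros; ring.
Qed.

(** Equality of sequences, where [bounded_d] has a pointwise form, so that images can be rewritten;
    [D] lets it serve maps on [d], on l_p and on all sequences. *)
Definition lin_on (D : seqR -> Prop) (T : op) : Prop :=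
  forall x y s t, D x -> D y ->
    T (sadd (sscale s x) (sscale t y)) = sadd (sscale s (T x)) (sscale t (T y)).

Lemma rsum_geom e n : 0 < e -> rsum (fun i => e * (1 / 2) ^ S i) n <= e.
Proof.
  intros He. assert (E : rsum (fun i => e * (1 / 2) ^ S i) n = e * (1 - (1 / 2) ^ n)).
  { induction n; [simpl; ring|]. simpl in *. rewrite IHn. field. }
  rewrite E. assert (0 < (1 / 2) ^ n) by (apply pow_lt; lra). nra.
Qed.

(** Every coefficient of [a] is at most [lpnorm p a], so on finitely supported sequences the errors
    add up to a geometric series. The bound [C] may be arbitrary: it only serves to pass to the
    limit. *)
Lemma near_identity (F : op) C e : 0 < e ->
  lin_on (in_lp p) F ->
  (forall a, in_lp p a -> in_d w p (F a) /\ dnorm w p (F a) <= C * lpnorm p a) ->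
  (forall n, dnorm w p (ssub (F (unit_seq n)) (unit_seq n)) <= e * (1 / 2) ^ S n) ->
  forall a, in_lp p a -> dnorm w p (ssub (F a) a) <= e * lpnorm p a.
Proof.
  intros He HL HC HF a Ha. set (G := fun b => ssub (F b) b).
  assert (GL : lin_on (in_lp p) G).
  { intros x y s t Hx Hy. unfold G. rewrite HL by easy.
    apply functional_extensionality; intros k. unfold ssub, sadd, sscale; ring. }
  assert (GC : forall b, in_lp p b -> in_d w p (G b) /\ dnorm w p (G b) <= (C + 1) * lpnorm p b).
  { intros b Hb. destruct (HC b Hb) as (I1 & B1). destruct (lp_in_d b Hb) as (I2 & B2).
    destruct (dnorm_ssub _ _ I1 I2). split; [easy|]. unfold G. lra. }
  assert (Lh : forall K, in_lp p (restr (below K) a)).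
  { intros K. apply (lp_finite_support _ K). intros k Hk. unfold restr, below.
    destruct (Nat.ltb_spec k K); [lia|easy]. }
  assert (H : forall K, dnorm w p (G (restr (below K) a)) <= lpnorm p a * rsum (fun i => e * (1 / 2) ^ S i) K).
  { induction K as [|K IH].
    - replace (restr (below 0) a) with (sadd (sscale 0 a) (sscale 0 a)).
      + rewrite GL by easy. simpl. rewrite Rmult_0_r.
        replace (sadd (sscale 0 (G a)) (sscale 0 (G a))) with (fun _ : nat => 0); [apply dnorm_zero|].
        apply functional_extensionality; intros k; unfold sadd, sscale; ring.
      + apply functional_extensionality; intros k; unfold sadd, sscale, restr; simpl; ring.
    - replace (restr (below (S K)) a) with (sadd (sscale 1 (restr (below K) a)) (sscale (a K) (unit_seq K))).
      + destruct (lpnorm_unit K) as (IK & _). rewrite GL by auto.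
        destruct (GC _ (Lh K)) as (I1 & _). destruct (GC _ IK) as (I2 & _).
        destruct (dnorm_sscale 1 _ I1) as (I3 & B3). destruct (dnorm_sscale (a K) _ I2) as (I4 & B4).
        destruct (dnorm_sadd _ _ I3 I4) as (_ & B5).
        rewrite Rabs_R1 in B3. pose proof (HF K) as HFK.
        fold (G (unit_seq K)) in HFK. pose proof (abs_le_lpnorm a K Ha). pose proof (Rabs_pos (a K)).
        pose proof (dnorm_ge0 (G (unit_seq K))).
        assert (Rabs (a K) * dnorm w p (G (unit_seq K)) <= lpnorm p a * (e * (1 / 2) ^ S K))
          by (apply Rmult_le_compat; easy).
        change (rsum (fun i => e * (1 / 2) ^ S i) (S K))
          with (rsum (fun i => e * (1 / 2) ^ S i) K + e * (1 / 2) ^ S K). lra.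
      + apply functional_extensionality; intros k. unfold sadd, sscale, restr, below, unit_seq.
        destruct (Nat.ltb_spec k K), (Nat.ltb_spec k (S K)), (Nat.eqb_spec k K); subst; try lia; ring. }
  apply le_epsilon. intros d Hd.
  pose proof (lpnorm_ge0 a) as La.
  (* [C] may be negative, while the tail tolerance [d / C'] needs a positive divisor above
     [C + 1]. *)
  set (C' := Rabs C + 1). assert (HC' : 0 < C' /\ C + 1 <= C' ) by (unfold C'; pose proof (Rle_abs C); pose proof (Rabs_pos C); lra).
  destruct (lp_from_small a (d / C') Ha) as (K & IK & BK); [apply Rdiv_lt_0_compat; lra|].
  replace a with (sadd (sscale 1 (restr (below K) a)) (sscale 1 (restr (from K) a))) at 1 2.
  2: { apply functional_extensionality; intros k. unfold sadd, sscale, restr, below, from.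
       destruct (Nat.ltb_spec k K), (Nat.leb_spec K k); try lia; ring. }
  fold (G (sadd (sscale 1 (restr (below K) a)) (sscale 1 (restr (from K) a)))).
  rewrite GL by auto.
  destruct (GC _ (Lh K)) as (I1 & _). destruct (GC _ IK) as (I2 & B2).
  destruct (dnorm_sscale 1 _ I1) as (I3 & B3). destruct (dnorm_sscale 1 _ I2) as (I4 & B4).
  destruct (dnorm_sadd _ _ I3 I4) as (_ & B5). rewrite Rabs_R1 in *.
  specialize (H K). pose proof (rsum_geom e K He).
  pose proof (lpnorm_ge0 (restr (from K) a)).
  assert (C' * (d / C') = d) by (field; lra).
  assert (lpnorm p a * rsum (fun i => e * (1 / 2) ^ S i) K <= lpnorm p a * e) by (apply Rmult_le_compat_l; easy).
  assert ((C + 1) * lpnorm p (restr (from K) a) <= C' * (d / C')).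
  { apply Rle_trans with (C' * lpnorm p (restr (from K) a)); [apply Rmult_le_compat_r; lra|].
    apply Rmult_le_compat_l; lra. }
  lra.
Qed.

(** * Factoring the formal identity through a non-compact operator *)

Lemma bounded_d_intro T C : lin_on (in_d w p) T ->
  (forall x, in_d w p x -> in_d w p (T x) /\ dnorm w p (T x) <= C * dnorm w p x) ->
  bounded_d w p T.
Proof.
  intros L B. split; [|split].
  - intros x Hx. now apply B.
  - intros x y s t Hx Hy k. now rewrite L.
  - exists C. intros x Hx. now apply B.
Qed.

Lemma bounded_d_elim T : bounded_d w p T -> lin_on (in_d w p) T /\
  exists C, 0 < C /\ forall x, in_d w p x -> in_d w p (T x) /\ dnorm w p (T x) <= C * dnorm w p x.
Proof.
  intros (I & L & C & B). split.
  - intros x y s t Hx Hy. apply functional_extensionality; intros k. now apply L.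
  - exists (Rabs C + 1). pose proof (Rabs_pos C). split; [lra|]. intros x Hx. split; [auto|].
    eapply Rle_trans; [now apply B|]. apply Rmult_le_compat_r; [apply dnorm_ge0|].
    pose proof (Rle_abs C). lra.
Qed.

Lemma lin_on_ssub D T x y : lin_on D T -> D x -> D y -> T (ssub x y) = ssub (T x) (T y).
Proof. intros L Hx Hy. rewrite !ssub_lin. now apply L. Qed.

Lemma sscale_lin s x : sscale s x = sadd (sscale s x) (sscale 0 x).
Proof. apply functional_extensionality; intros k; unfold sadd, sscale; ring. Qed.

Lemma lin_on_sscale D T s x : lin_on D T -> D x -> T (sscale s x) = sscale s (T x).
Proof. intros L Hx. rewrite sscale_lin, (sscale_lin s (T x)). now apply L. Qed.

(** Coordinates are added one at a time: the range of the new one is cut into cells of width [e],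
    and the net for the earlier ones is taken inside each cell. Hence the quantification over [D] in
    the induction, and the net points inside [D]. *)
Lemma finite_net (A : Type) (g : nat -> A -> R) B e m (D : A -> Prop) :
  (forall i x, D x -> Rabs (g i x) <= B) -> 0 < e ->
  exists L, (forall z, In z L -> D z) /\
    forall x, D x -> exists z, In z L /\ forall i, (i < m)%nat -> Rabs (g i x - g i z) <= e.
Proof.
  intros HB He. revert D HB. induction m as [|m IH]; intros D HB.
  - destruct (classic (exists z, D z)) as [(z & Hz)|N].
    + exists (z :: nil). split; [intros y [<-|[]]; easy|].
      intros x _. exists z. split; [now left|intros; lia].
    + exists nil. split; [easy|]. intros x Hx. exfalso; eauto.
  - assert (cell : forall E : A -> Prop, (forall x, E x -> D x) ->
      (forall x z, E x -> E z -> Rabs (g m x - g m z) <= e) ->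
      exists L, (forall z, In z L -> E z) /\
        forall x, E x -> exists z, In z L /\ forall i, (i < S m)%nat -> Rabs (g i x - g i z) <= e).
    { intros E ED EE. destruct (IH E) as (L & HL & HN); [auto|].
      exists L. split; [easy|]. intros x Hx. destruct (HN x Hx) as (z & Hz & Hi).
      exists z. split; [easy|]. intros i Hi'. destruct (Nat.eq_dec i m) as [->|].
      - apply EE; auto.
      - apply Hi; lia. }
    (* The net grows by one cell per step, upwards from the level [- B]. *)
    assert (sweep : forall q, exists L, (forall z, In z L -> D z) /\
      forall x, D x -> g m x <= - B + INR q * e ->
        exists z, In z L /\ forall i, (i < S m)%nat -> Rabs (g i x - g i z) <= e).
    { induction q as [|q (L & HL & HN)].
      - destruct (cell (fun x => D x /\ g m x <= - B)) as (L & HL & HN).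
        + now intros x [].
        + intros x z (Hx & Bx) (Hz & Bz). pose proof (HB m x Hx) as X. pose proof (HB m z Hz) as Z.
          apply Rabs_le_between in X. apply Rabs_le_between in Z. apply Rabs_le. lra.
        + exists L. split; [intros z Hz; now apply HL|]. intros x Hx Hb. apply HN. simpl in Hb. split; [easy|lra].
      - destruct (cell (fun x => D x /\ - B + INR q * e < g m x <= - B + INR (S q) * e)) as (L' & HL' & HN').
        + now intros x [].
        + rewrite S_INR. intros x z (Hx & Bx) (Hz & Bz). apply Rabs_le. lra.
        + exists (L ++ L'). split.
          * intros z Hz. apply in_app_or in Hz. destruct Hz; [auto|now apply HL'].
          * intros x Hx Hb. destruct (Rle_dec (g m x) (- B + INR q * e)) as [Hq|Hq].
            -- destruct (HN x Hx Hq) as (z & Hz & Hi). exists z. split; [apply in_or_app; now left|easy].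
            -- destruct (HN' x) as (z & Hz & Hi); [split; [easy|lra]|].
               exists z. split; [apply in_or_app; now right|easy]. }
    destruct (nfloor_ex (Rabs (2 * B / e)) (Rabs_pos _)) as (q & _ & Hq).
    destruct (sweep (S q)) as (L & HL & HN). exists L. split; [easy|].
    intros x Hx. apply HN; [easy|]. pose proof (HB m x Hx) as X. apply Rabs_le_between in X.
    pose proof (Rle_abs (2 * B / e)). rewrite S_INR.
    assert (2 * B / e * e = 2 * B) by (field; lra).
    assert (2 * B / e * e <= (INR q + 1) * e) by (apply Rmult_le_compat_r; lra). lra.
Qed.

Definition block (M N k : nat) : bool := (M <=? k) && (k <? N).

Lemma block_spec M N k : block M N k = true <-> (M <= k < N)%nat.
Proof. unfold block. rewrite andb_true_iff, Nat.leb_le, Nat.ltb_lt. easy. Qed.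

Lemma restr_block_in M N x k : (M <= k < N)%nat -> restr (block M N) x k = x k.
Proof. intros H. apply block_spec in H. unfold restr. now rewrite H. Qed.

Lemma restr_block_out M N x k : ~ (M <= k < N)%nat -> restr (block M N) x k = 0.
Proof.
  intros H. unfold restr. destruct (block M N k) eqn:E; [|easy]. now apply block_spec in E.
Qed.

Lemma block_complement M N x : (M <= N)%nat ->
  ssub x (restr (block M N) x) = sadd (restr (below M) x) (restr (from N) x).
Proof.
  intros H. apply functional_extensionality; intros k. unfold ssub, sadd, restr, block, below, from.
  destruct (Nat.leb_spec M k), (Nat.ltb_spec k N), (Nat.ltb_spec k M), (Nat.leb_spec N k); simpl; try lia; ring.
Qed.

Lemma dnorm_block_complement M N x e : (M <= N)%nat -> in_d w p x ->
  (forall i, (i < M)%nat -> Rabs (x i) <= e / 2 / (INR M + 1)) -> 0 <= e ->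
  dnorm w p (restr (from N) x) <= e / 2 ->
  dnorm w p (ssub x (restr (block M N) x)) <= e.
Proof.
  intros HMN Hx Hh He Ht. rewrite block_complement by easy.
  destruct (dnorm_below M x _ Hh) as (I & B). destruct (dnorm_restr (from N) x Hx) as (I' & _).
  destruct (dnorm_sadd _ _ I I') as (_ & T).
  pose proof (pos_INR M).
  assert (INR M * (e / 2 / (INR M + 1)) <= e / 2).
  { apply Rmult_le_reg_r with (INR M + 1); [lra|]. field_simplify; [nra|lra]. }
  lra.
Qed.

(* A net for the coordinates of [x] and [T x] gives two points that agree there while [T] separates them. *)
Lemma noncompact_humps T : bounded_d w p T -> ~ compact_op w p T ->
  exists e, 0 < e /\ forall N h, 0 < h -> exists u K,
    (forall k, u k <> 0 -> (N <= k < K)%nat) /\ in_d w p u /\ dnorm w p u <= 2 /\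
    (forall i, (i < N)%nat -> Rabs (T u i) <= h) /\ e <= dnorm w p (T u).
Proof.
  intros HT NC.
  assert (X : exists e, 0 < e /\ forall L, (forall z, In z L -> in_d w p z) ->
     exists x, in_d w p x /\ dnorm w p x <= 1 /\ forall z, In z L -> e < dnorm w p (ssub (T x) z)).
  { apply NNPP. intros N. apply NC. split; [easy|]. intros e He. apply NNPP. intros NL.
    apply N. exists e. split; [easy|]. intros L HL. apply NNPP. intros Nx.
    apply NL. exists L. split; [easy|]. intros x Hx Bx. apply NNPP. intros Nz.
    apply Nx. exists x. repeat split; auto; try apply Hx. intros z Hz. apply Rnot_le_lt. intros Lz. apply Nz. eauto. }
  destruct X as (e & He & X).
  destruct (bounded_d_elim T HT) as (TL & C & HC & TB).
  exists (e / 2). split; [lra|]. intros N h Hh.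
  pose proof (pos_INR N) as HN.
  (* The discarded part [v - u] will have norm at most [(N + 1) d]: [N] small coordinates and one
     tail. The second bound keeps its image within [h / 2] and [e / 2]; the first gives the other
     half of [h] to the coordinates of [T v]. *)
  set (d := Rmin (h / 2) (Rmin h e / (2 * C * (INR N + 1)))).
  assert (Hme : 0 < Rmin h e) by (now apply Rmin_glb_lt).
  assert (HCN : 0 < 2 * C * (INR N + 1)) by (repeat apply Rmult_lt_0_compat; lra).
  assert (Hd : 0 < d) by (apply Rmin_glb_lt; [lra|now apply Rdiv_lt_0_compat]).
  assert (Hd1 : d <= h / 2) by apply Rmin_l.
  assert (Hd2 : C * ((INR N + 1) * d) <= Rmin h e / 2).
  { replace (Rmin h e / 2) with (C * ((INR N + 1) * (Rmin h e / (2 * C * (INR N + 1))))) by (field; lra).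
    repeat (apply Rmult_le_compat_l; [lra|]). apply Rmin_r. }
  pose proof (Rmin_l h e). pose proof (Rmin_r h e).
  set (D := fun x => in_d w p x /\ dnorm w p x <= 1).
  (* The first [N] functions read coordinates of [x], the next [N] read coordinates of [T x];
     [1 + C] bounds both kinds on the unit ball. *)
  destruct (finite_net seqR (fun i x => if i <? N then x i else T x (i - N)%nat) (1 + C) d (N + N) D)
    as (L & HL & HN'); [|easy|].
  { intros i x (Ix & Bx). destruct (TB x Ix) as (It & Bt). destruct (i <? N).
    - pose proof (abs_le_dnorm x i Ix). lra.
    - pose proof (abs_le_dnorm (T x) (i - N) It).
      apply (Rmult_le_compat_l C) in Bx; lra. }
  (* The images of the net points are no [e]-net for the image of the unit ball, so some [T x] is
     far from all of them, although [x] nearly agrees with one net point on the chosen coordinates.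
     Being a difference of two points of the ball, [x - z] has norm at most 2. *)
  destruct (X (map T L)) as (x & Ix & Bx & Sx).
  { intros z Hz. apply in_map_iff in Hz. destruct Hz as (z' & <- & Hz'). apply TB. now apply HL. }
  destruct (HN' x) as (z & Hz & Hc); [now split|].
  destruct (HL z Hz) as (Iz & Bz).
  specialize (Sx (T z) (in_map T L z Hz)).
  rewrite <- (lin_on_ssub (in_d w p)) in Sx by easy.
  destruct (dnorm_ssub x z Ix Iz) as (Iv & Bv).
  assert (c1 : forall i, (i < N)%nat -> Rabs (ssub x z i) <= d).
  { intros i Hi. specialize (Hc i ltac:(lia)). destruct (Nat.ltb_spec i N); [easy|lia]. }
  assert (c2 : forall i, (i < N)%nat -> Rabs (T (ssub x z) i) <= d).
  { intros i Hi. rewrite (lin_on_ssub (in_d w p)) by easy.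
    specialize (Hc (N + i)%nat ltac:(lia)). destruct (Nat.ltb_spec (N + i) N); [lia|].
    now replace (N + i - N)%nat with i in Hc by lia. }
  set (v := ssub x z) in *.
  destruct (dnorm_from_small v d Iv Hd) as (K & HK). specialize (HK (max K N) ltac:(lia)).
  set (u := restr (block N (max K N)) v).
  destruct (dnorm_restr (block N (max K N)) v Iv) as (Iu & Bu). fold u in Iu, Bu.
  destruct (dnorm_ssub v u Iv Iu) as (Id & _).
  assert (Buv : dnorm w p (ssub v u) <= (INR N + 1) * d).
  { unfold u. rewrite block_complement by lia. destruct (dnorm_below N v d c1) as (I & B).
    destruct (dnorm_restr (from (max K N)) v Iv) as (I' & _). destruct (dnorm_sadd _ _ I I') as (_ & ?). lra. }
  destruct (TB _ Id) as (Itd & Btd). destruct (TB _ Iu) as (Itu & _). destruct (TB _ Iv) as (Itv & _).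
  rewrite (lin_on_ssub (in_d w p)) in Itd, Btd by easy.
  assert (Btd' : dnorm w p (ssub (T v) (T u)) <= Rmin h e / 2).
  { eapply Rle_trans; [exact Btd|]. eapply Rle_trans; [|exact Hd2]. apply Rmult_le_compat_l; lra. }
  exists u, (max K N). repeat split; try easy.
  - destruct (Nat.le_gt_cases N k); [easy|]. exfalso; apply H1. unfold u. apply restr_block_out; lia.
  - destruct (Nat.le_gt_cases (max K N) k); [|easy]. exfalso; apply H1. unfold u. apply restr_block_out; lia.
  - apply Iu.
  - apply Iu.
  - lra.
  - intros i Hi. specialize (c2 i Hi).
    pose proof (abs_le_dnorm _ i Itd) as E. unfold ssub in E.
    replace (T u i) with (T v i - (T v i - T u i)) by ring.
    eapply Rle_trans; [apply Rabs_triang|]. rewrite Rabs_Ropp. fold (ssub (T v) (T u) i) in *.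
    unfold ssub in *. lra.
  - pose proof (dnorm_le_ssub (T v) (T u) Itv Itu). lra.
Qed.

(** By linearity the second clause says that [phi] reads only coordinates of the block, so it makes
    sense on all sequences. *)
Definition local_functional (M N : nat) (phi : seqR -> R) : Prop :=
  (forall x y s t, phi (sadd (sscale s x) (sscale t y)) = s * phi x + t * phi y) /\
  (forall x, (forall k, (M <= k < N)%nat -> x k = 0) -> phi x = 0).

(** [Q] abstracts the kind of functional, so that both cases share one stacking argument. The value
    1 is required on the cut image, not on [T u]: then [V] sends cut images exactly to unit vectors,
    and only the cutting error remains. *)
Definition hump (T : op) (Q : nat -> nat -> (seqR -> R) -> Prop) (M : nat) (e : R)
    (N : nat) (u : seqR) (phi : seqR -> R) : Prop :=
  (M < N)%nat /\ (forall k, u k <> 0 -> (M <= k < N)%nat) /\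
  (in_d w p u /\ dnorm w p u <= 2) /\ Q M N phi /\ phi (restr (block M N) (T u)) = 1 /\
  dnorm w p (ssub (T u) (restr (block M N) (T u))) <= e.

(* Stacks humps on successive blocks: [V T U] is a small perturbation of the formal identity from l_p to d. *)
Lemma factor_identity T Q (Good : op -> Prop) C : bounded_d w p T -> 0 < C ->
  (forall M N phi, Q M N phi -> local_functional M N phi) ->
  (forall (N : nat -> nat) phi, (forall n, (N n < N (S n))%nat) ->
     (forall n, Q (N n) (N (S n)) (phi n)) -> Good (fun x n => phi n x)) ->
  (forall V, Good V -> forall x, in_d w p x -> in_d w p (V x) /\ dnorm w p (V x) <= C * dnorm w p x) ->
  (forall M e, 0 < e -> exists N u phi, hump T Q M e N u phi) ->
  forall e, 0 < e -> exists U V : op,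
    lin_on (fun _ => True) U /\
    (forall a, in_lp p a -> in_d w p (U a) /\ dnorm w p (U a) <= 2 * lpnorm p a) /\
    lin_on (fun _ => True) V /\ Good V /\
    forall a, in_lp p a -> dnorm w p (ssub (V (T (U a))) a) <= e * lpnorm p a.
Proof.
  intros HT HC HQ HG HV Hh e He.
  destruct (bounded_d_elim T HT) as (TL & CT & HCT & TB).
  (* After multiplication by the bound [C] of [V], this is the error that [near_identity] allows at
     index [n]. *)
  set (ep := fun n => e * (1 / 2) ^ S n / C).
  assert (Hep : forall n, 0 < ep n).
  { intros n. apply Rdiv_lt_0_compat; [|easy]. apply Rmult_lt_0_compat; [easy|]. apply pow_lt; lra. }
  assert (CH : forall n M, { d : nat * seqR * (seqR -> R) | hump T Q M (ep n) (fst (fst d)) (snd (fst d)) (snd d) }).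
  { intros n M. apply constructive_indefinite_description.
    destruct (Hh M (ep n) (Hep n)) as (N & u & phi & H). now exists (N, u, phi). }
  (* Dependent choice: each hump starts where the previous block ended and decides where its own
     block ends. *)
  assert (X : exists (N : nat -> nat) u phi, forall n, hump T Q (N n) (ep n) (N (S n)) (u n) (phi n)).
  { set (N := fix N n := match n with O => O | S n => fst (fst (proj1_sig (CH n (N n)))) end).
    exists N, (fun n => snd (fst (proj1_sig (CH n (N n))))), (fun n => snd (proj1_sig (CH n (N n)))).
    intros n. exact (proj2_sig (CH n (N n))). }
  destruct X as (N & u & phi & H).
  assert (HN : forall n, (N n < N (S n))%nat) by (intros n; exact (proj1 (H n))).
  assert (HS : forall n k, u n k <> 0 -> (N n <= k < N (S n))%nat) by (intros n; exact (proj1 (proj2 (H n)))).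
  assert (HQn : forall n, Q (N n) (N (S n)) (phi n)) by (intros n; exact (proj1 (proj2 (proj2 (proj2 (H n)))))).
  assert (Hun : forall n, in_d w p (u n) /\ dnorm w p (u n) <= 2) by (intros n; exact (proj1 (proj2 (proj2 (H n))))).
  destruct (incr_bound N HN) as (IB & _).
  set (U := synth u). set (V := fun x n => phi n x).
  assert (UB : forall a, in_lp p a -> in_d w p (U a) /\ dnorm w p (U a) <= 2 * lpnorm p a).
  { intros a Ha. apply (dnorm_synth N); auto; lra. }
  assert (VL : lin_on (fun _ => True) V).
  { intros x y s t _ _. apply functional_extensionality; intros n.
    unfold V. now apply (HQ (N n) (N (S n))). }
  assert (GV : Good V) by now apply (HG N phi).
  exists U, V. split; [|split; [|split; [|split]]]; auto.
  - intros x y s t _ _. apply synth_lin.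
  - apply (near_identity _ (C * (CT * 2))); [easy| | |].
    + intros x y s t Hx Hy. unfold U. rewrite synth_lin. rewrite TL by now apply UB.
      now apply VL.
    + intros a Ha. destruct (UB a Ha) as (I1 & B1). destruct (TB _ I1) as (I2 & B2).
      destruct (HV V GV _ I2) as (I3 & B3). split; [easy|].
      eapply Rle_trans; [exact B3|]. rewrite Rmult_assoc. apply Rmult_le_compat_l; [lra|].
      eapply Rle_trans; [exact B2|]. rewrite Rmult_assoc. apply Rmult_le_compat_l; lra.
    + intros n. unfold U. rewrite synth_unit.
      2: { intros k Hk. apply NNPP. intros Hne. apply HS in Hne. specialize (IB n). lia. }
      destruct (H n) as (_ & _ & (Iu & _) & _ & E1 & Err).
      destruct (TB _ Iu) as (It & _).
      destruct (dnorm_restr (block (N n) (N (S n))) (T (u n)) It) as (Ib & _).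
      set (b := restr (block (N n) (N (S n))) (T (u n))) in *.
      (* The functional of block [n] takes the value 1 on [b], and those of the other blocks do not
         see it. *)
      replace (unit_seq n) with (V b).
      * rewrite <- (lin_on_ssub (fun _ => True)) by easy.
        destruct (dnorm_ssub _ _ It Ib) as (Id & _).
        eapply Rle_trans; [apply (HV V GV _ Id)|].
        apply Rle_trans with (C * ep n); [apply Rmult_le_compat_l; lra|].
        apply Req_le. unfold ep. field. lra.
      * apply functional_extensionality; intros m. unfold V, unit_seq.
        destruct (Nat.eqb_spec m n) as [->|Hmn]; [easy|].
        apply (HQ (N m) (N (S m))); [easy|]. intros k Hk. apply restr_block_out.
        intros Hk'. apply Hmn. now apply (block_unique N m n k).
Qed.

(** * Images with a coordinate bounded below *)

Definition coord_functional (d : R) (M N : nat) (phi : seqR -> R) : Prop :=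
  exists k c, (M <= k < N)%nat /\ Rabs c <= / d /\ phi = fun x => c * x k.

Lemma coord_functional_local d M N phi : coord_functional d M N phi -> local_functional M N phi.
Proof.
  intros (k & c & Hk & _ & ->). split.
  - intros x y s t. unfold sadd, sscale. ring.
  - intros x Hx. rewrite Hx by easy. ring.
Qed.

(** One coordinate per block is an injective selection, and an arrangement of the selected sequence
    is an arrangement of [x]. Multiplication by scalars bounded by [/ d] costs only that factor. *)
Lemma coord_functional_bounded d (N : nat -> nat) phi x : 0 < d ->
  (forall n, (N n < N (S n))%nat) -> (forall n, coord_functional d (N n) (N (S n)) (phi n)) ->
  in_d w p x ->
  in_d w p (fun n => phi n x) /\ dnorm w p (fun n => phi n x) <= / d * dnorm w p x.
Proof.
  intros Hd HN HQ Hx.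
  assert (Hid : 0 < / d) by now apply Rinv_0_lt_compat.
  assert (CH : forall n, { k | (N n <= k < N (S n))%nat /\ exists c, Rabs c <= / d /\ phi n = fun x => c * x k}).
  { intros n. apply constructive_indefinite_description.
    destruct (HQ n) as (k & c & Hk & Hc & E). exists k; eauto. }
  set (ks := fun n => proj1_sig (CH n)).
  assert (Hks : forall n, (N n <= ks n < N (S n))%nat) by (intros n; apply (proj2_sig (CH n))).
  assert (Hph : forall n, Rabs (phi n x) <= / d * Rabs (x (ks n))).
  { intros n. destruct (proj2 (proj2_sig (CH n))) as (c & Hc & ->). rewrite Rabs_mult.
    apply Rmult_le_compat_r; [apply Rabs_pos|easy]. }
  destruct (incr_bound N HN) as (IB & _).
  assert (Hsel : in_d w p (fun n => x (ks n)) /\ dnorm w p (fun n => x (ks n)) <= dnorm w p x).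
  { apply dnorm_le; [|apply dnorm_ge0|].
    - apply is_lim_seq_0_intro. intros e He. destruct (is_lim_seq_0_elim x e (proj1 Hx) He) as (n0 & Hn0).
      exists n0. intros n Hn. apply Hn0. specialize (IB n). specialize (Hks n). lia.
    - intros t M Ht. apply (wsum_upto_le_dnorm x (fun k => ks (t k)) M Hx).
      intros i j Hi Hj E. apply Ht; auto. apply (block_unique N _ _ (ks (t i)) HN); [apply Hks|].
      rewrite E. apply Hks. }
  destruct (dnorm_mono _ _ (/ d) ltac:(lra) (proj1 Hsel) Hph) as (I & B).
  split; [easy|]. eapply Rle_trans; [exact B|]. apply Rmult_le_compat_l; [lra|apply Hsel].
Qed.

Lemma coord_hump T d : bounded_d w p T -> 0 < d ->
  (forall N h, 0 < h -> exists u K,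
    (forall k, u k <> 0 -> (N <= k < K)%nat) /\ in_d w p u /\ dnorm w p u <= 2 /\
    (forall i, (i < N)%nat -> Rabs (T u i) <= h) /\ exists k, d < Rabs (T u k)) ->
  forall M e, 0 < e -> exists N u phi, hump T (coord_functional d) M e N u phi.
Proof.
  intros HT Hd H M e He. pose proof (pos_INR M) as HM.
  assert (Hq : 0 < e / 2 / (INR M + 1)) by (repeat apply Rdiv_lt_0_compat; lra).
  (* The bound by [d] on the coordinates of [T u] below [M] forces the large coordinate [k] to lie
     at or after [M]. *)
  destruct (H M (Rmin (e / 2 / (INR M + 1)) d)) as (u & K & Su & Iu & Bu & Sm & k & Hk);
    [now apply Rmin_glb_lt|].
  pose proof (Rmin_l (e / 2 / (INR M + 1)) d). pose proof (Rmin_r (e / 2 / (INR M + 1)) d).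
  destruct (bounded_d_elim T HT) as (_ & C & HC & TB). destruct (TB u Iu) as (It & _).
  destruct (dnorm_from_small (T u) (e / 2) It ltac:(lra)) as (N0 & HN0).
  set (N := max (max K (S k)) (max N0 (S M))).
  assert (HMk : (M <= k)%nat).
  { destruct (Nat.le_gt_cases M k) as [?|L]; [easy|]. specialize (Sm k L). lra. }
  exists N, u, (fun x => / T u k * x k). split; [lia|]. split; [|split; [easy|split; [|split]]].
  - intros i Hi. apply Su in Hi. lia.
  - exists k, (/ T u k). split; [lia|]. split; [|easy].
    rewrite Rabs_inv. apply Rinv_le_contravar; lra.
  - rewrite restr_block_in by lia. apply Rinv_l. intros E. rewrite E, Rabs_R0 in Hk. lra.
  - apply dnorm_block_complement; auto; try lia; try lra.
    + intros i Hi. specialize (Sm i Hi). lra.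
    + apply HN0. lia.
Qed.

(** * Images with small sup norm *)

Definition lp_functional (r : R) (M N : nat) (phi : seqR -> R) : Prop :=
  local_functional M N phi /\
  exists G t, (forall k, G k = true -> (M <= k < N)%nat /\ (M <= t k < N)%nat) /\ inj_on G t /\
    forall x, rpow (Rabs (phi x)) p <=
      r * rsum (fun k => if G k then w k * rpow (Rabs (x (t k))) p else 0) N.

(** Positions [k] and indices [t k] of each functional both stay in its block, so the partial
    arrangements of successive blocks glue into a single one. The sum of all the bounds is then [r]
    times one weighted sum, which [wsum_le_dnorm] controls. *)
Lemma lp_functional_bounded r (N : nat -> nat) phi x : 0 <= r ->
  (forall n, (N n < N (S n))%nat) -> (forall n, lp_functional r (N n) (N (S n)) (phi n)) ->
  in_d w p x ->
  in_lp p (fun n => phi n x) /\ lpnorm p (fun n => phi n x) <= rpow r (1 / p) * dnorm w p x.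
Proof.
  intros Hr HN HQ Hx.
  assert (K : forall n, exists G t, (forall k, G k = true -> (k < N n)%nat /\ (t k < N n)%nat) /\
    inj_on G t /\ rsum (fun j => rpow (Rabs (phi j x)) p) n <=
      r * rsum (fun k => if G k then w k * rpow (Rabs (x (t k))) p else 0) (N n)).
  { induction n as [|n (G & t & HG & It & B)].
    - exists (fun _ => false), (fun k => k). split; [easy|split; [easy|]].
      rewrite rsum_0 with (n := N 0%nat) by easy. simpl. lra.
    - destruct (HQ n) as (_ & G' & t' & HG' & It' & B').
      specialize (HN n).
      exists (fun k => if k <? N n then G k else G' k), (fun k => if k <? N n then t k else t' k).
      split; [|split].
      + intros k. destruct (Nat.ltb_spec k (N n)) as [Hk|Hk]; intros E.
        * apply HG in E. lia.
        * apply HG' in E. lia.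
      + intros i j. destruct (Nat.ltb_spec i (N n)), (Nat.ltb_spec j (N n)); intros Ei Ej E.
        * now apply It.
        * apply HG in Ei. apply HG' in Ej. lia.
        * apply HG' in Ei. apply HG in Ej. lia.
        * now apply It'.
      + simpl. rewrite (rsum_ext _ (fun k => (if G k then w k * rpow (Rabs (x (t k))) p else 0) +
                                   (if G' k then w k * rpow (Rabs (x (t' k))) p else 0)) (N (S n))).
        * rewrite rsum_plus,
            (rsum_extend (fun k => if G k then w k * rpow (Rabs (x (t k))) p else 0) (N n) (N (S n))); [|lia|].
          -- specialize (B' x). rewrite Rmult_plus_distr_l. now apply Rplus_le_compat.
          -- intros i Hi. destruct (G i) eqn:E; [|easy]. apply HG in E. lia.
        * intros k _. destruct (Nat.ltb_spec k (N n)) as [Hk|Hk].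
          -- destruct (G' k) eqn:E; [apply HG' in E; lia|ring].
          -- destruct (G k) eqn:E; [apply HG in E; lia|ring]. }
  apply lpnorm_le.
  - apply Rmult_le_pos; [apply rpow_ge0|apply dnorm_ge0].
  - intros n. destruct (K n) as (G & t & _ & It & B).
    rewrite rpow_mult by (apply rpow_ge0 || apply dnorm_ge0).
    rewrite rpow_rpow; [|field; lra|easy].
    eapply Rle_trans; [exact B|]. apply Rmult_le_compat_l; [easy|]. now apply wsum_le_dnorm.
Qed.

(* The functional norms [T u] on the part of its norming arrangement that lies in the block;
   flatness of [T u] makes the discarded part small. *)
Lemma flat_hump T e0 : bounded_d w p T -> 0 < e0 ->
  (forall N h, 0 < h -> exists u K,
    (forall k, u k <> 0 -> (N <= k < K)%nat) /\ in_d w p u /\ dnorm w p u <= 2 /\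
    (forall i, Rabs (T u i) <= h) /\ e0 <= dnorm w p (T u)) ->
  forall M e, 0 < e -> exists N u phi, hump T (lp_functional (2 / rpow (e0 / 2) p)) M e N u phi.
Proof.
  intros HT He0 H M e He. pose proof (pos_INR M) as HM.
  set (D0 := rpow (e0 / 2) p). assert (HD0 : 0 < D0) by (apply rpow_gt0; lra).
  assert (Hq : 0 < e / 2 / (INR M + 1)) by (repeat apply Rdiv_lt_0_compat; lra).
  assert (Hq2 : 0 < D0 / 4 / (INR M + 1)) by (repeat apply Rdiv_lt_0_compat; lra).
  assert (ip : p * (1 / p) = 1) by (field; lra). assert (ip' : 1 / p * p = 1) by (field; lra).
  (* [h1] pays for the [M] largest weights, as [M h^p <= D0 / 4]; [h2] pays for the coordinates
     below [M], whose part of [y] has norm at most [M h]. *)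
  set (h1 := rpow (D0 / 4 / (INR M + 1)) (1 / p)).
  set (h2 := rpow (D0 / 4) (1 / p) / (INR M + 1)).
  assert (Hh1 : 0 < h1) by now apply rpow_gt0.
  assert (Hh2 : 0 < h2) by (apply Rdiv_lt_0_compat; [apply rpow_gt0; lra|lra]).
  set (h := Rmin (e / 2 / (INR M + 1)) (Rmin h1 h2)).
  assert (Hh : 0 < h) by (repeat apply Rmin_glb_lt; auto).
  assert (hl1 : h <= e / 2 / (INR M + 1)) by apply Rmin_l.
  assert (hl2 : h <= h1) by (eapply Rle_trans; [apply Rmin_r|apply Rmin_l]).
  assert (hl3 : h <= h2) by (eapply Rle_trans; [apply Rmin_r|apply Rmin_r]).
  assert (E1 : INR M * rpow h p <= D0 / 4).
  { apply (rpow_mono p) in hl2; [|easy]. unfold h1 in hl2. rewrite rpow_rpow in hl2 by lra.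
    apply Rle_trans with (INR M * (D0 / 4 / (INR M + 1))); [apply Rmult_le_compat_l; lra|].
    apply Rmult_le_reg_r with (INR M + 1); [lra|]. field_simplify; [nra|lra]. }
  assert (E2 : rpow (INR M * h) p <= D0 / 4).
  { rewrite <- (rpow_rpow (1 / p) p (D0 / 4)) by lra. apply rpow_mono; [easy|].
    replace (rpow (D0 / 4) (1 / p)) with ((INR M + 1) * h2) by (unfold h2; field; lra). nra. }
  destruct (H M h Hh) as (u & K & Su & Iu & Bu & Fl & Lo).
  destruct (bounded_d_elim T HT) as (_ & C & HC & TB). destruct (TB u Iu) as (It & _).
  set (y := T u) in *.
  destruct (dnorm_gt_witness y (e0 / 2) It ltac:(lra) ltac:(lra)) as (t & L & Ht & HL). fold D0 in HL.
  destruct (dnorm_from_small y (e / 2) It ltac:(lra)) as (N0 & HN0).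
  set (N := max (max K (max L (S (list_max (map t (seq 0 L)))))) (max N0 (S M))).
  assert (HtN : forall i, (i < L)%nat -> (t i < N)%nat).
  { intros i Hi. assert (t i <= list_max (map t (seq 0 L)))%nat; [|lia].
    apply In_le_list_max, in_map, in_seq. lia. }
  set (nz := fun k => if Req_EM_T (y k) 0 then false else true).
  (* Positions and indices are both moved past [M]; zeros of [y] are dropped because the functional
     divides by these entries. *)
  set (G := fun k => block M L k && (M <=? t k) && nz (t k)).
  assert (HG : forall k, G k = true -> (M <= k < L)%nat /\ (M <= t k < N)%nat /\ y (t k) <> 0).
  { intros k Hk. unfold G in Hk. apply andb_true_iff in Hk. destruct Hk as (Hk & Hn).
    apply andb_true_iff in Hk. destruct Hk as (Hk & Hm). apply block_spec in Hk. apply Nat.leb_le in Hm.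
    split; [easy|]. split; [split; [easy|apply HtN; lia]|].
    unfold nz in Hn. now destruct (Req_EM_T (y (t k)) 0). }
  set (s := fun k => w k * rpow (Rabs (y (t k))) p).
  assert (s0 : forall k, 0 <= s k) by (intros; apply wpow_ge0).
  change (D0 < rsum s L) in HL.
  set (D := rsum (fun k => if G k then s k else 0) N).
  assert (HD : D0 / 2 < D).
  { destruct (dnorm_below M y h) as (Ib & Bb); [auto|].
    (* A position outside [G] is below [M], or reads a coordinate below [M], or reads a zero. The
       first two kinds cost at most [D0 / 4] each, out of a total above [D0]. *)
    assert (S1 : rsum s L <= rsum (fun k => (if G k then s k else 0) + ((if k <? M then rpow h p else 0) +
               w k * rpow (Rabs (restr (below M) y (t k))) p)) L).
    { apply rsum_le. intros k Hk. unfold G, restr, below, block, nz.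
      pose proof (wpow_ge0 k (Rabs 0)). pose proof (s0 k). pose proof (rpow_ge0 h p).
      pose proof (w_le1 k). pose proof (w_ge0 k). pose proof (rpow_ge0 (Rabs (y (t k))) p).
      assert (rpow (Rabs (y (t k))) p <= rpow h p) by (apply rpow_mono; auto).
      destruct (Nat.leb_spec M k), (Nat.ltb_spec k L), (Nat.ltb_spec k M), (Nat.leb_spec M (t k)),
        (Nat.ltb_spec (t k) M); simpl; try lia;
      try (destruct (Req_EM_T (y (t k)) 0) as [Z|]); unfold s in *; try rewrite Z, Rabs_R0, rpow_0 in *;
        try nra. }
    rewrite !rsum_plus in S1.
    assert (S2 : rsum (fun k => if G k then s k else 0) L = D).
    { symmetry. apply rsum_extend; [lia|]. intros i Hi. destruct (G i) eqn:E; [|easy]. apply HG in E. lia. }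
    assert (S3 : rsum (fun k => if k <? M then rpow h p else 0) L <= INR M * rpow h p).
    { apply Rle_trans with (rsum (fun k => if k <? M then rpow h p else 0) (M + L)).
      - apply rsum_grow; [|lia]. intros i. destruct (i <? M); [apply rpow_ge0|lra].
      - rewrite (rsum_extend _ M); [|lia|].
        + rewrite <- rsum_const. apply rsum_le. intros i _. destruct (i <? M); [lra|apply rpow_ge0].
        + intros i Hi. destruct (Nat.ltb_spec i M); [lia|easy]. }
    assert (S4 := wsum_upto_le_dnorm _ t L Ib Ht).
    apply (rpow_mono p) in Bb; [|easy]. lra. }
  set (th := fun k => s k / D).
  assert (th0 : forall k, 0 <= th k).
  { intros k. apply Rmult_le_pos; [apply s0|left; apply Rinv_0_lt_compat; lra]. }
  assert (th1 : rsum (fun k => if G k then th k else 0) N = 1).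
  { rewrite (rsum_ext _ (fun k => / D * (if G k then s k else 0))).
    - rewrite rsum_scal. fold D. apply Rinv_l. lra.
    - intros k _. unfold th. destruct (G k); [field; lra|ring]. }
  (* A weighted mean of the ratios [x / y] along the arrangement, so its value at [y] is 1. By
     Jensen its p-th power is at most the mean of the powers, where the choice of [th] cancels
     [|y|^p] and leaves [w k |x (t k)|^p / D]; [D > D0 / 2] explains the constant [2 / D0]. *)
  exists N, u, (fun x => rsum (fun k => if G k then th k * (x (t k) / y (t k)) else 0) N).
  split; [lia|]. split; [|split; [easy|split; [|split]]].
  - intros k Hk. apply Su in Hk. lia.
  - split; [split|].
    + intros x z a b. rewrite <- !rsum_scal, <- rsum_plus. apply rsum_ext. intros k _.
      destruct (G k); [|ring]. unfold sadd, sscale, Rdiv. ring.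
    + intros x Hx. apply rsum_0. intros k _. destruct (G k) eqn:E; [|easy]. apply HG in E.
      rewrite Hx by lia. unfold Rdiv. ring.
    + exists G, t. split; [intros k Hk; apply HG in Hk; lia|]. split.
      { intros i j Hi Hj. apply Ht; [apply HG in Hi; lia|apply HG in Hj; lia]. }
      intros x.
      apply Rle_trans with (rpow (rsum (fun k => if G k then th k * (Rabs (x (t k)) / Rabs (y (t k))) else 0) N) p).
      * apply rpow_mono; [easy|].
        assert (TR : forall f m, Rabs (rsum f m) <= rsum (fun k => Rabs (f k)) m).
        { intros f m. induction m; simpl; [rewrite Rabs_R0; lra|].
          eapply Rle_trans; [apply Rabs_triang|lra]. }
        eapply Rle_trans; [apply TR|]. apply Req_le, rsum_ext. intros k _.
        destruct (G k); [|apply Rabs_R0]. unfold Rdiv. now rewrite !Rabs_mult, Rabs_inv, (Rabs_pos_eq (th k)).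
      * eapply Rle_trans; [apply (rpow_jensen G th); auto|].
        { intros k. unfold Rdiv. rewrite <- Rabs_inv, <- Rabs_mult. apply Rabs_pos. }
        rewrite <- rsum_scal. apply rsum_le. intros k _.
        destruct (G k) eqn:E; [|lra]. apply HG in E. destruct E as (_ & _ & Hy).
        assert (Hya : 0 < Rabs (y (t k))) by now apply Rabs_pos_lt.
        assert (Hyp := rpow_gt0 _ p Hya).
        assert (EQ : rpow (Rabs (x (t k))) p = rpow (Rabs (x (t k)) / Rabs (y (t k))) p * rpow (Rabs (y (t k))) p).
        { rewrite <- rpow_mult; [f_equal; field; lra| |lra].
          unfold Rdiv. rewrite <- Rabs_inv, <- Rabs_mult. apply Rabs_pos. }
        rewrite EQ. unfold th, s.
        set (X := rpow (Rabs (x (t k)) / Rabs (y (t k))) p).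
        replace (w k * rpow (Rabs (y (t k))) p / D * X) with (/ D * (w k * (X * rpow (Rabs (y (t k))) p)))
          by (field; lra).
        apply Rmult_le_compat_r.
        { apply Rmult_le_pos; [apply w_ge0|]. apply Rmult_le_pos; [apply rpow_ge0|lra]. }
        replace (2 / D0) with (/ (D0 / 2)) by (field; lra). apply Rinv_le_contravar; lra.
  - rewrite <- th1. apply rsum_ext. intros k _. destruct (G k) eqn:E; [|easy]. apply HG in E.
    rewrite restr_block_in by lia. unfold Rdiv. rewrite Rinv_r by easy. ring.
  - apply dnorm_block_complement; auto; try lia; try lra.
    + intros i _. apply Rle_trans with h; auto.
    + apply HN0. lia.
Qed.

Lemma noncompact_factors T : bounded_d w p T -> ~ compact_op w p T ->
  forall e, 0 < e -> exists U V : op,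
    lin_on (fun _ => True) U /\
    (forall a, in_lp p a -> in_d w p (U a) /\ dnorm w p (U a) <= 2 * lpnorm p a) /\
    bounded_d w p V /\
    forall a, in_lp p a -> dnorm w p (ssub (V (T (U a))) a) <= e * lpnorm p a.
Proof.
  intros HT NC e He.
  destruct (noncompact_humps T HT NC) as (e0 & He0 & H).
  destruct (classic (forall N h, 0 < h -> exists u K,
    (forall k, u k <> 0 -> (N <= k < K)%nat) /\ in_d w p u /\ dnorm w p u <= 2 /\
    (forall i, Rabs (T u i) <= h) /\ e0 <= dnorm w p (T u))) as [Flat|NF].
  - set (r := 2 / rpow (e0 / 2) p).
    assert (Hr : 0 < r) by (apply Rdiv_lt_0_compat; [lra|apply rpow_gt0; lra]).
    destruct (factor_identity T (lp_functional r)
      (fun V => forall x, in_d w p x -> in_lp p (V x) /\ lpnorm p (V x) <= rpow r (1 / p) * dnorm w p x)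
      (rpow r (1 / p))) with (e := e) as (U & V & LU & BU & LV & GV & HUV); auto.
    + now apply rpow_gt0.
    + intros M N phi Q. apply Q.
    + intros N phi HN HQ x Hx. apply (lp_functional_bounded r N); auto; lra.
    + intros V G x Hx. destruct (G x Hx) as (I & B). destruct (lp_in_d _ I). split; [easy|lra].
    + now apply flat_hump.
    + exists U, V. split; [easy|split; [easy|split; [|easy]]].
      apply bounded_d_intro with (rpow r (1 / p)).
      * intros x y s t _ _. now apply LV.
      * intros x Hx. destruct (GV x Hx) as (I & B). destruct (lp_in_d _ I). split; [easy|lra].
  - assert (X : exists N0 h0, 0 < h0 /\ forall u K, (forall k, u k <> 0 -> (N0 <= k < K)%nat) ->
      in_d w p u -> dnorm w p u <= 2 -> e0 <= dnorm w p (T u) -> exists k, h0 < Rabs (T u k)).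
    { apply NNPP. intros N. apply NF. intros N0 h Hh. apply NNPP. intros Nu. apply N.
      exists N0, h. split; [easy|]. intros u K Su Iu Bu Lo. apply NNPP. intros Nk. apply Nu.
      exists u, K. repeat split; auto; try apply Su; auto; try apply Iu.
      intros i. apply Rnot_lt_le. intros L. apply Nk. eauto. }
    destruct X as (N0 & h0 & Hh0 & X).
    destruct (factor_identity T (coord_functional h0)
      (fun V => forall x, in_d w p x -> in_d w p (V x) /\ dnorm w p (V x) <= / h0 * dnorm w p x)
      (/ h0)) with (e := e) as (U & V & LU & BU & LV & GV & HUV); auto.
    + now apply Rinv_0_lt_compat.
    + apply coord_functional_local.
    + intros N phi HN HQ x Hx. now apply (coord_functional_bounded h0 N).
    + apply coord_hump; auto. intros N h Hh.
      destruct (H (max N N0) h Hh) as (u & K & Su & Iu & Bu & Sm & Lo).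
      exists u, K. split; [intros k Hk; apply Su in Hk; lia|].
      split; [easy|split; [easy|split]].
      * intros i Hi. apply Sm. lia.
      * apply (X u K); auto. intros k Hk. apply Su in Hk. lia.
    + exists U, V. split; [easy|split; [easy|split; [|easy]]].
      apply bounded_d_intro with (/ h0); [|easy]. intros x y s t _ _. now apply LV.
Qed.

(** * Ideals *)

Lemma closed_ideal_contains_Jj J T : closed_ideal w p J -> J T -> ~ compact_op w p T ->
  forall S, Jj w p S -> J S.
Proof.
  intros (JB & _ & _ & _ & JL & JR & JC) JT NC S (HS & A & B & HA & HB & ES).
  apply JC. split; [easy|]. intros e He.
  destruct (bounded_d_elim A HA) as (AL & CA & HCA & AB).
  destruct HB as (BI & BL & CB & BB).
  set (CB' := Rabs CB + 1). assert (HCB : 0 < CB' /\ CB <= CB').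
  { unfold CB'. pose proof (Rabs_pos CB). pose proof (Rle_abs CB). lra. }
  assert (HCC : 0 < CA * CB') by (apply Rmult_lt_0_compat; lra).
  destruct (noncompact_factors T (JB T JT) NC (e / (CA * CB'))) as (U & V & LU & BU & HV & HUV);
    [now apply Rdiv_lt_0_compat|].
  (* [U] is only bounded on l_p, so the ideal property of [J] is applied to [T] and the composite
     [U B], which is an operator on [d]. *)
  assert (HUB : bounded_d w p (fun x => U (B x))).
  { apply bounded_d_intro with (2 * CB').
    - intros x y s t Hx Hy.
      replace (B (sadd (sscale s x) (sscale t y))) with (sadd (sscale s (B x)) (sscale t (B y)));
        [now apply LU|].
      symmetry. apply functional_extensionality; intros k. now apply BL.
    - intros x Hx. destruct (BU (B x) (BI x Hx)) as (I & N). split; [easy|].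
      specialize (BB x Hx). pose proof (dnorm_ge0 x).
      assert (CB * dnorm w p x <= CB' * dnorm w p x) by (apply Rmult_le_compat_r; lra). lra. }
  exists (fun x => A (V (T (U (B x))))). split.
  - apply (JL A (fun x => V (T (U (B x)))) HA). apply (JL V (fun x => T (U (B x))) HV).
    exact (JR (fun x => U (B x)) T HUB JT).
  - intros x Hx. specialize (BI x Hx). specialize (BB x Hx).
    destruct (lp_in_d _ BI) as (Ib & _). destruct (BU _ BI) as (Iu & _).
    destruct (bounded_d_elim T (JB T JT)) as (_ & CT & _ & TB).
    destruct (bounded_d_elim V HV) as (_ & CV & _ & VB).
    destruct (VB _ (proj1 (TB _ Iu))) as (Iv & _).
    replace (S x) with (A (B x)) by (apply functional_extensionality; intros k; now rewrite ES).
    replace (ssub (A (B x)) (A (V (T (U (B x)))))) with (A (sscale (-1) (ssub (V (T (U (B x)))) (B x)))).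
    + destruct (dnorm_ssub _ _ Iv Ib) as (Id & _). destruct (dnorm_sscale (-1) _ Id) as (In & Bn).
      rewrite Rabs_left in Bn by lra.
      eapply Rle_trans; [apply (AB _ In)|].
      specialize (HUV _ BI). pose proof (dnorm_ge0 x).
      assert (lpnorm p (B x) <= CB' * dnorm w p x) by (eapply Rle_trans; [exact BB|]; apply Rmult_le_compat_r; lra).
      assert (He' : 0 < e / (CA * CB')) by now apply Rdiv_lt_0_compat.
      replace (e * dnorm w p x) with (CA * (e / (CA * CB') * (CB' * dnorm w p x))) by (field; lra).
      apply Rmult_le_compat_l; [lra|].
      apply Rle_trans with (e / (CA * CB') * lpnorm p (B x)); [lra|].
      apply Rmult_le_compat_l; lra.
    + destruct (dnorm_ssub _ _ Iv Ib) as (Id & _).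
      rewrite (lin_on_sscale (in_d w p)), (lin_on_ssub (in_d w p)) by easy.
      apply functional_extensionality; intros k. unfold sscale, ssub. ring.
Qed.

Lemma Jj_closure_subset J : closed_ideal w p J -> (exists T, J T /\ ~ compact_op w p T) ->
  forall T, Jj_closure w p T -> J T.
Proof.
  intros HJ (T0 & JT & NC) T (HT & HS). apply HJ. split; [easy|].
  intros e He. destruct (HS e He) as (S & JS & D). exists S. split; [|easy].
  now apply (closed_ideal_contains_Jj J T0).
Qed.

(** * The closure of J^j strictly contains the compact operators *)

Lemma Jj_in_closure S : Jj w p S -> Jj_closure w p S.
Proof.
  intros HS. split; [apply HS|]. intros e He. exists S. split; [easy|]. intros x Hx.
  replace (ssub (S x) (S x)) with (fun _ : nat => 0).
  - destruct dnorm_zero as (_ & Z). pose proof (dnorm_ge0 x). nra.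
  - apply functional_extensionality; intros k. unfold ssub. ring.
Qed.

(** A truncated image has at most [N] non-zero entries, each at most the norm in [d], so it lies in
    l_p with the constant [N^(1/p)]. The second truncation, as the left factor, brings it back to
    [d] unchanged. *)
Lemma Jj_below T N : bounded_d w p T -> Jj w p (fun x => restr (below N) (T x)).
Proof.
  intros HT. destruct (bounded_d_elim T HT) as (TL & C & HC & TB).
  split; [|exists (restr (below N)), (fun x => restr (below N) (T x)); split; [|split]].
  - apply bounded_d_intro with C.
    + intros x y s t Hx Hy. rewrite TL by easy. apply restr_lin.
    + intros x Hx. destruct (TB x Hx) as (I & B). destruct (dnorm_restr (below N) _ I). split; [easy|lra].
  - apply bounded_d_intro with 1.
    + intros x y s t _ _. apply restr_lin.
    + intros x Hx. rewrite Rmult_1_l. now apply dnorm_restr.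
  - split; [|split].
    + intros x Hx. apply (lp_finite_support _ N). intros k Hk. unfold restr, below.
      destruct (Nat.ltb_spec k N); [lia|easy].
    + intros x y s t Hx Hy k. now rewrite TL, restr_lin.
    + set (R := rpow (INR N) (1 / p)). exists (R * C). intros x Hx. destruct (TB x Hx) as (I & B).
      apply lpnorm_le.
      * apply Rmult_le_pos; [apply Rmult_le_pos; [apply rpow_ge0|lra]|apply dnorm_ge0].
      * intros n. rewrite Rmult_assoc, rpow_mult; [|apply rpow_ge0|apply Rmult_le_pos; [lra|apply dnorm_ge0]].
        unfold R. rewrite rpow_rpow by (try apply pos_INR; field; lra).
        set (f := fun k => rpow (Rabs (restr (below N) (T x) k)) p).
        apply Rle_trans with (rsum f (N + n)); [apply rsum_grow; [intros; apply rpow_ge0|lia]|].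
        rewrite (rsum_extend _ N); [|lia|].
        -- rewrite <- rsum_const. apply rsum_le. intros k Hk. apply rpow_mono; [easy|].
           unfold restr, below. destruct (Nat.ltb_spec k N); [|lia].
           eapply Rle_trans; [now apply abs_le_dnorm|easy].
        -- intros i Hi. unfold f, restr, below. destruct (Nat.ltb_spec i N); [lia|]. now rewrite Rabs_R0, rpow_0.
  - intros x Hx k. unfold restr. now destruct (below N k).
Qed.

Lemma finite_uniform_tail e L : 0 < e -> (forall z, In z L -> in_d w p z) ->
  exists N0, forall z N, In z L -> (N0 <= N)%nat -> dnorm w p (restr (from N) z) <= e.
Proof.
  intros He. induction L as [|z L IH]; intros H.
  - exists 0%nat. easy.
  - destruct IH as (N1 & H1); [intros; apply H; now right|].
    destruct (dnorm_from_small z e) as (N2 & H2); [apply H; now left|easy|].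
    exists (max N1 N2). intros y N [<-|Hy] HN; [apply H2; lia|apply H1; auto; lia].
Qed.

(** A totally bounded image has uniformly small tails: a finite net has them, and restriction does
    not increase distances. Hence the truncations of [T], which are in [J^j], converge to [T] in
    norm. *)
Lemma compact_in_Jj_closure T : compact_op w p T -> Jj_closure w p T.
Proof.
  intros (HT & HK). split; [easy|]. intros e He.
  destruct (bounded_d_elim T HT) as (TL & C & HC & TB).
  destruct (HK (e / 2)) as (L & HL & HN); [lra|].
  destruct (finite_uniform_tail (e / 2) L) as (N & HNL); [lra|easy|].
  exists (fun x => restr (below N) (T x)). split; [now apply Jj_below|].
  intros x Hx.
  replace (ssub (T x) (restr (below N) (T x))) with (restr (from N) (T x)).
  2: { apply functional_extensionality; intros k. unfold ssub, restr, below, from.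
       destruct (Nat.ltb_spec k N), (Nat.leb_spec N k); try lia; ring. }
  assert (unit_case : forall y, in_d w p y -> dnorm w p y <= 1 -> dnorm w p (restr (from N) (T y)) <= e).
  { intros y Hy By. destruct (HN y Hy By) as (z & Hz & Bz). specialize (HL z Hz).
    destruct (TB y Hy) as (It & _). destruct (dnorm_ssub _ _ It HL) as (Id & _).
    destruct (dnorm_restr (from N) _ Id) as (_ & Bd). specialize (HNL z N Hz (Nat.le_refl N)).
    destruct (dnorm_restr (from N) _ It) as (I1 & _). destruct (dnorm_restr (from N) _ HL) as (I2 & _).
    pose proof (dnorm_le_ssub _ _ I1 I2) as Q.
    replace (ssub (restr (from N) (T y)) (restr (from N) z)) with (restr (from N) (ssub (T y) z)) in Q; [lra|].
    rewrite !ssub_lin. apply restr_lin. }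
  destruct (TB x Hx) as (It & Bt). destruct (dnorm_restr (from N) _ It) as (Ir & Br).
  (* Homogeneity carries the estimate from the unit ball to [x]; a vector of norm 0 cannot be
     rescaled, and there boundedness of [T] suffices. *)
  destruct (Req_dec (dnorm w p x) 0) as [Z|NZ].
  - rewrite Z, Rmult_0_r in *. lra.
  - pose proof (dnorm_ge0 x). set (r := dnorm w p x) in *.
    assert (Hr : 0 < r) by lra.
    destruct (dnorm_sscale (/ r) x Hx) as (Is & Bs). fold r in Bs.
    assert (Hir : 0 < / r) by now apply Rinv_0_lt_compat.
    rewrite Rabs_pos_eq, Rinv_l in Bs by lra.
    specialize (unit_case _ Is Bs).
    rewrite (lin_on_sscale (in_d w p)) in unit_case by easy.
    set (y := restr (from N) (T x)) in *.
    replace (restr (from N) (sscale (/ r) (T x))) with (sscale (/ r) y) in unit_case.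
    2: { unfold y. rewrite (sscale_lin _ (T x)), restr_lin. apply sscale_lin. }
    destruct (dnorm_sscale (/ r) y Ir) as (Iy & _). destruct (dnorm_sscale r _ Iy) as (_ & By).
    rewrite Rabs_pos_eq in By by lra.
    replace y with (sscale r (sscale (/ r) y)).
    2: { apply functional_extensionality; intros k. unfold sscale. field. lra. }
    eapply Rle_trans; [exact By|]. rewrite Rmult_comm. apply Rmult_le_compat_r; lra.
Qed.

(** A constant [c] on [m] coordinates has norm 1 when [c^p] is the inverse of the sum of the first
    [m] weights. Divergence of that sum makes [c] small; the bound 2 is only the form that
    [flat_hump] asks for. *)
Lemma flat_vector N h : 0 < h -> exists u K,
  (forall k, u k <> 0 -> (N <= k < K)%nat) /\ in_d w p u /\ dnorm w p u <= 2 /\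
  (forall i, Rabs (u i) <= h) /\ 1 <= dnorm w p u.
Proof.
  intros Hh. destruct Hw as (_ & _ & _ & Hdiv).
  apply is_lim_seq_spec in Hdiv. destruct (Hdiv (rpow (/ h) p)) as (m0 & Hm0).
  specialize (Hm0 m0 (Nat.le_refl _)). rewrite <- rsum_sum_n in Hm0.
  set (m := S m0) in *. set (sm := rsum w m) in *.
  assert (Hih : 0 < / h) by now apply Rinv_0_lt_compat.
  assert (Hihp := rpow_gt0 _ p Hih).
  assert (Hsm : 0 < / sm) by (apply Rinv_0_lt_compat; lra).
  set (c := rpow (/ sm) (1 / p)).
  assert (Hc : 0 < c) by now apply rpow_gt0.
  assert (Ec : rpow c p = / sm) by (apply rpow_rpow; [field; lra|lra]).
  assert (Hch : c <= h).
  { apply rpow_le_reg; [lra|]. rewrite Ec.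
    apply Rmult_le_reg_l with (rpow (/ h) p); [easy|]. rewrite <- rpow_mult by lra.
    rewrite Rinv_l, rpow_1 by lra.
    apply Rmult_le_reg_r with sm; [lra|]. rewrite Rmult_assoc, Rinv_l by lra. lra. }
  set (u := restr (block N (N + m)) (fun _ => c)).
  assert (Au : forall k, Rabs (u k) <= c).
  { intros k. unfold u, restr. destruct (block N (N + m) k).
    - rewrite Rabs_pos_eq; lra.
    - rewrite Rabs_R0; lra. }
  assert (C0 : in_c0 u).
  { apply is_lim_seq_0_intro. intros e He. exists (N + m)%nat. intros n Hn. unfold u.
    rewrite restr_block_out by lia. rewrite Rabs_R0; lra. }
  set (f := fun n => w n * rpow (xstar u n) p).
  destruct (Series_bounded f 1) as (E & B); [intros; apply wpow_ge0| |].
  { intros n. apply Rle_trans with (rsum f (m + n)); [apply rsum_grow; [intros; apply wpow_ge0|lia]|].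
    rewrite (rsum_extend _ m); [|lia|].
    - apply Rle_trans with (rsum (fun k => / sm * w k) m).
      + apply rsum_le. intros k _. unfold f. rewrite Rmult_comm. apply Rmult_le_compat_r; [apply w_ge0|].
        rewrite <- Ec. apply rpow_mono; [easy|]. now apply xstar_le_sup.
      + rewrite rsum_scal. fold sm. rewrite Rinv_l; lra.
    - intros i Hi. unfold f. rewrite (xstar_finite_supp u i (seq N m)); auto.
      + rewrite rpow_0; ring.
      + rewrite length_seq; lia.
      + intros k Hk. apply restr_block_out. intros Hk'. apply Hk, in_seq. lia. }
  assert (Iu : in_d w p u) by now split.
  exists u, (N + m)%nat. split; [|split; [easy|split; [|split]]].
  - intros k Hk. apply NNPP. intros Hn. apply Hk. now apply restr_block_out.
  - apply Rle_trans with 1; [|lra]. apply rpow_le_reg; [lra|].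
    rewrite dnorm_pow, rpow_1 by easy. exact B.
  - intros i. specialize (Au i). lra.
  - apply rpow_le_reg; [apply dnorm_ge0|].
    eapply Rle_trans; [|apply (wsum_upto_le_dnorm u (fun k => N + k)%nat m Iu)].
    + rewrite rpow_1, (rsum_ext _ (fun k => / sm * w k)).
      * rewrite rsum_scal. fold sm. rewrite Rinv_l; lra.
      * intros i Hi. unfold u. rewrite restr_block_in by lia. rewrite Rabs_pos_eq, Ec by lra. ring.
    + intros i j _ _ E'. lia.
Qed.

(** For the identity operator the flat case gives [U] and a [V] from [d] to l_p with [V U] close to
    the formal identity. With the identity as left factor, [V] is in [J^j], and it is not compact
    because the vectors [V U f_n] stay near the [e_n]. *)
Lemma noncompact_in_Jj : exists S, Jj w p S /\ ~ compact_op w p S.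
Proof.
  assert (HI : bounded_d w p (fun x => x)).
  { apply bounded_d_intro with 1; [easy|]. intros x Hx. split; [easy|lra]. }
  set (r := 2 / rpow (1 / 2) p).
  assert (Hr : 0 < r) by (apply Rdiv_lt_0_compat; [lra|apply rpow_gt0; lra]).
  destruct (factor_identity (fun x => x) (lp_functional r)
    (fun V => forall x, in_d w p x -> in_lp p (V x) /\ lpnorm p (V x) <= rpow r (1 / p) * dnorm w p x)
    (rpow r (1 / p))) with (e := 1 / 3) as (U & V & _ & BU & LV & GV & HUV); auto.
  - now apply rpow_gt0.
  - intros M N phi Q. apply Q.
  - intros N phi HN HQ x Hx. apply (lp_functional_bounded r N); auto; lra.
  - intros V G x Hx. destruct (G x Hx) as (I & B). destruct (lp_in_d _ I). split; [easy|lra].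
  - apply flat_hump; auto; [lra|]. intros N h. apply flat_vector.
  - lra.
  - assert (HV : bounded_d w p V).
    { apply bounded_d_intro with (rpow r (1 / p)).
      - intros x y s t _ _. now apply LV.
      - intros x Hx. destruct (GV x Hx) as (I & B). destruct (lp_in_d _ I). split; [easy|lra]. }
    exists V. split.
    + split; [easy|]. exists (fun x => x), V. split; [easy|split; [|easy]].
      split; [intros x Hx; now apply GV|split].
      * intros x y s t Hx Hy k. now rewrite LV.
      * exists (rpow r (1 / p)). intros x Hx. now apply GV.
    + intros (_ & HK). destruct (HK (1 / 12)) as (L & HL & HN); [lra|].
      destruct (finite_uniform_tail (1 / 24) L) as (N & HNL); [lra|easy|].
      (* [U] at most doubles norms, whence the factor [1 / 2]. Coordinate [N] of [V (U f_N)] is at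
         least [2/3], so its half is at least [1/3] and coordinate [N] of the nearby net point at
         least [1/4], against the bound [1/24] on the tail of that point. *)
      destruct (lpnorm_unit N) as (Iu & Bu). destruct (BU _ Iu) as (IU & BU').
      destruct (dnorm_sscale (1 / 2) _ IU) as (Ix & Bx). rewrite Rabs_pos_eq in Bx by lra.
      destruct (HN _ Ix ltac:(lra)) as (z & Hz & Bz).
      rewrite (lin_on_sscale (fun _ => True)) in Bz by easy.
      destruct (bounded_d_elim V HV) as (_ & C & _ & VB). destruct (VB _ IU) as (IV & _).
      destruct (lp_in_d _ Iu) as (Id & _).
      specialize (HUV _ Iu).
      pose proof (abs_le_dnorm _ N (proj1 (dnorm_ssub _ _ IV Id))) as E1.
      pose proof (abs_le_dnorm _ N (proj1 (dnorm_ssub _ _ (proj1 (dnorm_sscale (1 / 2) _ IV)) (HL z Hz)))) as E2.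
      pose proof (abs_le_dnorm _ N (proj1 (dnorm_restr (from N) z (HL z Hz)))) as E3.
      specialize (HNL z N Hz (Nat.le_refl N)).
      replace (restr (from N) z N) with (z N) in E3 by (unfold restr, from; now rewrite Nat.leb_refl).
      assert (F1 : Rabs (V (U (unit_seq N)) N - unit_seq N N) <= 1 / 3) by (eapply Rle_trans; [exact E1|lra]).
      assert (F2 : Rabs (1 / 2 * V (U (unit_seq N)) N - z N) <= 1 / 12) by exact (Rle_trans _ _ _ E2 Bz).
      replace (unit_seq N N) with 1 in F1 by (unfold unit_seq; now rewrite Nat.eqb_refl).
      apply Rabs_le_between in F1. apply Rabs_le_between in F2. apply Rabs_le_between in E3.
      lra.
Qed.
End Norm.

Theorem theorem4p7 (w : seqR) (p : R) :
  1 <= p -> lorentz_weight w -> exactly_two_symmetric w p ->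
  (* K(d) is strictly contained in the closure of J^j *)
  ((forall T, compact_op w p T -> Jj_closure w p T) /\
   (exists T, Jj_closure w p T /\ ~ compact_op w p T)) /\
  (* no closed ideal strictly between *)
  ~ (exists J, closed_ideal w p J /\
       (forall T, compact_op w p T -> J T) /\ (exists T, J T /\ ~ compact_op w p T) /\
       (forall T, J T -> Jj_closure w p T) /\ (exists T, Jj_closure w p T /\ ~ J T)) /\
  (* every closed ideal strictly above K(d) contains the closure of J^j *)
  (forall J, closed_ideal w p J ->
     (forall T, compact_op w p T -> J T) -> (exists T, J T /\ ~ compact_op w p T) ->
     forall T, Jj_closure w p T -> J T).
Proof.
  intros Hp Hw _. split; [split|split].
  - now apply compact_in_Jj_closure.
  - destruct (noncompact_in_Jj w p Hp Hw) as (S & HS & NC). exists S. split; [|easy].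
    now apply Jj_in_closure.
  - intros (J & HJ & _ & NC & _ & T & HT & NT). apply NT. now apply (Jj_closure_subset w p Hp Hw J).
  - intros J HJ _ NC. now apply (Jj_closure_subset w p Hp Hw J).
Qed.
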